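(* Let $A$ be either $\mathbb{H}$ or $\mathbb{O}$. Let $\Omega\subset A$ be an open circular set and let $f$ be a slice-Nash function on $\Omega$. Then, for each integer $n\ge 1$, the $n$-th slice derivative $\frac{\partial^n f}{\partial x^n}:\Omega\to A$ of $f$ is a slice-Nash function on $\Omega$.
   Context: $\mathbb{H}$ denotes the quaternions and $\mathbb{O}$ the octonions; $\mathbb{S}_A=\{I\in A: I^2=-1\}$. Put $u_A=1$ if $A=\mathbb{H}$ and $u_A=3$ if $A=\mathbb{O}$. The complex field is $\mathbb{C}=\{\alpha+\iota\beta\}$ with $\iota\notin\mathbb{S}_A$. For $I\in\mathbb{S}_A$, $\mathbb{C}_I=\mathbb{R}+\mathbb{R}I$. For $D\subset\mathbb{C}$, $\Omega_D=\{\alpha+\beta I:\alpha+\iota\beta\in D,\ I\in\mathbb{S}_A\}$; $\Omega\subset A$ is circular if $\Omega=\Omega_D$ for some $D$, where $D$ is always taken non-empty and invariant under complex conjugation (then it is determined by $\Omega$). Elements of $A\otimes_{\mathbb{R}}\mathbb{C}$ are $x+\iota y$ ($x,y\in A$), with $\overline{x+\iota y}=x-\iota y$. A stem function on an open conjugation-invariant $D\subset\mathbb{C}$ is $F=F_1+\iota F_2:D\to A\otimes_{\mathbb{R}}\mathbb{C}$ with $F(\overline z)=\overline{F(z)}$. It induces the slice function $f=\mathcal{I}(F):\Omega_D\to A$, $f(\alpha+\beta I)=F_1(\alpha+\iota\beta)+I\,F_2(\alpha+\iota\beta)$; every slice function comes from a unique stem function. $f$ is slice regular if $F$ is holomorphic,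 i.e. $C^1$ with $\frac{\partial F}{\partial\alpha}+\iota\frac{\partial F}{\partial\beta}=0$. For $F$ of class $C^1$, the slice derivative of $f=\mathcal{I}(F)$ is $\frac{\partial f}{\partial x}=\mathcal{I}\big(\frac{\partial F}{\partial z}\big)$ with $\frac{\partial F}{\partial z}=\frac12\big(\frac{\partial F}{\partial\alpha}-\iota\frac{\partial F}{\partial\beta}\big)$; higher slice derivatives are defined by iteration. A function $g:D\to\mathbb{C}$ on an open $D\subset\mathbb{C}$ is complex Nash if every point of $D$ has an open neighbourhood $U\subset D$ on which $g$ is holomorphic and satisfies $P(z,g(z))=0$ for some non-zero $P\in\mathbb{C}[z,t]$. For $I\in\mathbb{S}_A$, $A$ is a $\mathbb{C}_I$-vector space by left multiplication; if $\{1,I_1,\ldots,I_{u_A}\}$ is a base over $\mathbb{C}_I$, then $\{I_0:=1,I,I_1,II_1,\ldots,I_{u_A},II_{u_A}\}$ is called a splitting base of $A$ associated to $I$. Write uniquely $F_s=\sum_{k=0}^{u_A}(F_{s,1}^{I,I_k}+F_{s,2}^{I,I_k}I)I_k$ ($s=1,2$) with real-valued coefficients, and $F^{\ell}_{I,I_k}=F_{1,\ell}^{I,I_k}+\iota F_{2,\ell}^{I,I_k}:D\to\mathbb{C}$ ($\ell=1,2$). $F$ is stem-Nash on $D$ if for some $I$ and some splitting base associated to $I$ all $F^{\ell}_{I,I_k}$ are complex Nash on $D$. $f=\mathcal{I}(F)$ is slice-Nash on $\Omega_D$ if it is slice regular and $F$ is stem-Nash on $D$. *)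

(* Defs.v *)
From HB Require Import structures.
From mathcomp Require Import all_boot all_order all_algebra.
From mathcomp Require Import polyXY complex.
From mathcomp Require Import boolp classical_sets reals.
From mathcomp Require Import topology normedtype derive.
From mathcomp Require Import ring.

Set Implicit Arguments.
Unset Strict Implicit.
Unset Printing Implicit Defensive.

Import Order.TTheory GRing.Theory Num.Theory.
Import numFieldNormedType.Exports.

Local Open Scope classical_set_scope.
Local Open Scope ring_scope.
Local Open Scope complex_scope.

(** ** The algebras: Cayley-Dickson doubling
    [cd R 0], [cd R 1], [cd R 2], [cd R 3] are the reals, the complex numbers,
    the quaternions and the octonions, with the product topology. *)

Section CayleyDickson.
Context (R : realType).

Fixpoint cd (n : nat) : normedModType R :=
  if n is m.+1 then (cd m * cd m)%type else R^o.

Fixpoint cd_one (n : nat) : cd n :=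
  if n is m.+1 return cd n then (cd_one m, 0) else (1 : R).

Fixpoint cd_conj (n : nat) : cd n -> cd n :=
  if n is m.+1 return cd n -> cd n
  then fun x => (cd_conj x.1, - x.2) else id.

(* This is the pair-wise doubled product, not the componentwise product that
   the library puts on pairs of rings. *)
Fixpoint cd_mul (n : nat) : cd n -> cd n -> cd n :=
  if n is m.+1 return cd n -> cd n -> cd n then
    fun x y => (cd_mul x.1 y.1 - cd_mul (cd_conj y.2) x.2,
                cd_mul y.2 x.1 + cd_mul x.2 (cd_conj y.1))
  else fun x y => (x : R) * (y : R).

End CayleyDickson.

Notation "x ** y" := (cd_mul x y) (at level 40, left associativity)
  : ring_scope.

Variant hypercomplex := Quaternions | Octonions.

Definition cd_level (A : hypercomplex) : nat :=
  match A with Quaternions => 2 | Octonions => 3 end.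

Notation carrier R A := (cd R (cd_level A)).

Definition u_ (A : hypercomplex) : nat :=
  match A with Quaternions => 1 | Octonions => 3 end.

Section SliceFunctions.
Context (R : realType) (A : hypercomplex).

(* [R[i]^o] is the complex field seen as a normed space over itself; this is
   the copy of [R[i]] that carries the library topology. *)
Local Notation C := (R[i]^o).
Local Notation AA := (carrier R A).
Local Notation "1A" := (cd_one R (cd_level A)).

Definition imag_units : set AA := [set I | I ** I = - 1A].

(* alpha + beta I, for z = alpha + iota beta *)
Definition slice_point (I : AA) (z : C) : AA :=
  complex.Re z *: 1A + complex.Im z *: I.

Definition conj_invariant (D : set C) : Prop := forall z : C, D z -> D z^*.

Definition circularization (D : set C) : set AA :=
  [set x | exists z I, [/\ D z, imag_units I & x = slice_point I z]].

Definition circular (Omega : set AA) : Prop :=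
  exists D, [/\ D !=set0, conj_invariant D & Omega = circularization D].

(* The D such that [Omega = circularization D]; see [profileK] below. *)
Definition profile (Omega : set AA) : set C :=
  [set z | exists2 I, imag_units I & Omega (slice_point I z)].

(** ** Stem functions; x + iota y in the complexification of A is (x, y) *)

Definition iota_mul (p : AA * AA) : AA * AA := (- p.2, p.1).

Definition stem_function (D : set C) (F : C -> AA * AA) : Prop :=
  [/\ open D, conj_invariant D &
      forall z : C, D z -> F z^* = ((F z).1, - (F z).2)].

Definition induces (D : set C) (F : C -> AA * AA) (f : AA -> AA) : Prop :=
  forall z I, D z -> imag_units I ->
    f (slice_point I z) = (F z).1 + I ** (F z).2.

(* The function induced by F on [circularization D], extended by 0; see
   [slice_function_induced] below. *)
Definition slice_function (D : set C) (F : C -> AA * AA) (x : AA) : AA :=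
  xget 0 [set y | exists z I, [/\ D z, imag_units I, x = slice_point I z
                                & y = (F z).1 + I ** (F z).2]].

Definition line_re (F : C -> AA * AA) (z : C) : R^o -> AA * AA :=
  fun t => F (t +i* complex.Im z).
Definition line_im (F : C -> AA * AA) (z : C) : R^o -> AA * AA :=
  fun t => F (complex.Re z +i* t).

Definition d_alpha (F : C -> AA * AA) (z : C) : AA * AA :=
  'D_1 (line_re F z) (complex.Re z).
Definition d_beta (F : C -> AA * AA) (z : C) : AA * AA :=
  'D_1 (line_im F z) (complex.Im z).

Definition of_class_C1 (D : set C) (F : C -> AA * AA) : Prop :=
  forall z, D z ->
    [/\ derivable (line_re F z) (complex.Re z) 1,
        derivable (line_im F z) (complex.Im z) 1,
        {for z, continuous (d_alpha F)} & {for z, continuous (d_beta F)}].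

Definition stem_holomorphic (D : set C) (F : C -> AA * AA) : Prop :=
  of_class_C1 D F /\
  forall z, D z -> d_alpha F z + iota_mul (d_beta F z) = 0.

Definition d_z (F : C -> AA * AA) (z : C) : AA * AA :=
  2^-1 *: (d_alpha F z - iota_mul (d_beta F z)).

(* Its values on the profile are determined by f on Omega; see
   [stem_function_unique] below. *)
Definition stem_of (Omega : set AA) (f : AA -> AA) : C -> AA * AA :=
  xget (fun=> 0) [set F | stem_function (profile Omega) F /\
                          induces (profile Omega) F f].

Definition slice_derivative (Omega : set AA) (f : AA -> AA) : AA -> AA :=
  slice_function (profile Omega) (d_z (stem_of Omega f)).

(** ** Nash functions *)

(* Here [derivable g w 1] has scalar field [R[i]]: it is complex
   differentiability at w. *)
Definition complex_nash (D : set C) (g : C -> C) : Prop :=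
  forall z, D z -> exists U : set C,
    [/\ open U, U z, U `<=` D, (forall w, U w -> derivable g w 1) &
      exists2 P : {poly {poly R[i]}}, P != 0 &
        forall w, U w -> P.[w, g w] = 0].

(* {1, J_1, ..., J_u} is a base of A as a left vector space over
   C_I = R + R I, a scalar of C_I being [slice_point I c]. *)
Definition splitting_base (I : AA) (J : 'I_(u_ A).+1 -> AA) : Prop :=
  [/\ imag_units I, J ord0 = 1A,
      (forall c : 'I_(u_ A).+1 -> C,
         \sum_k slice_point I (c k) ** J k = 0 -> forall k, c k = 0) &
      (forall x, exists c : 'I_(u_ A).+1 -> C,
         x = \sum_k slice_point I (c k) ** J k)].

(* [c_s k] = F_(s,1) + iota F_(s,2) is the C_I-coordinate of F_s along J_k; the
   functions required to be Nash are F_(1,l) + iota F_(2,l) for l = 1, 2. *)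
Definition stem_nash (D : set C) (F : C -> AA * AA) : Prop :=
  exists (I : AA) (J : 'I_(u_ A).+1 -> AA), splitting_base I J /\
  exists c1 c2 : 'I_(u_ A).+1 -> C -> C,
    (forall z, D z -> (F z).1 = \sum_k slice_point I (c1 k z) ** J k /\
                      (F z).2 = \sum_k slice_point I (c2 k z) ** J k) /\
    (forall k,
       complex_nash D (fun z => complex.Re (c1 k z) +i* complex.Re (c2 k z)) /\
       complex_nash D (fun z => complex.Im (c1 k z) +i* complex.Im (c2 k z))).

Definition slice_nash (Omega : set AA) (f : AA -> AA) : Prop :=
  exists F, [/\ stem_function (profile Omega) F, induces (profile Omega) F f,
                stem_holomorphic (profile Omega) F &
                stem_nash (profile Omega) F].

End SliceFunctions.

(** ** Consistency of the definitions: the products are the intended ones, the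
    profile of a circular set and the stem function are well defined, and so
    is the induced function. *)

Lemma quat_mulE (R : realType) (a b c d a' b' c' d' : R) :
  cd_mul (n := 2) ((a, b), (c, d)) ((a', b'), (c', d')) =
  ((a * a' - b * b' - c * c' - d * d', a * b' + b * a' + c * d' - d * c'),
   (a * c' - b * d' + c * a' + d * b', a * d' + b * c' - c * b' + d * a')).
Proof. by congr pair; congr pair => /=; ring. Qed.

Section CayleyDicksonTheory.
Context (R : realType).
Implicit Types n : nat.

Lemma cd_conjD n : {morph @cd_conj R n : x y / x + y}.
Proof.
elim: n => [|n IH]; first by move=> x y.
move=> [x x'] [y y']; congr pair => /=; first exact: IH.
by rewrite opprD.
Qed.

Lemma cd_conjZ n k : {morph @cd_conj R n : x / k *: x}.
Proof.
elim: n => [|n IH]; first by move=> x.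
move=> [x x']; congr pair => /=; first exact: IH.
by rewrite -scalerN.
Qed.

Lemma cd_mulD n : (left_distributive (@cd_mul R n) +%R *
                   right_distributive (@cd_mul R n) +%R)%type.
Proof.
elim: n => [|n [IHl IHr]]; first by split=> x y z /=; rewrite ?mulrDl ?mulrDr.
split=> -[x x'] [y y'] [z z']; congr pair; rewrite /= -!/(@cd_mul R n).
- by rewrite IHl IHr opprD addrACA.
- by rewrite IHr IHl addrACA.
- by rewrite cd_conjD IHl IHr opprD addrACA.
- by rewrite cd_conjD IHr IHl addrACA.
Qed.

Lemma cd_mulZ n k (x y : cd R n) :
  ((k *: x) ** y = k *: (x ** y)) * (x ** (k *: y) = k *: (x ** y)).
Proof.
elim: n x y => [|n IH] x y.
  by split; rewrite /= /GRing.scale /=; [rewrite mulrA | rewrite mulrCA].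
move: x y => [x x'] [y y']; split; congr pair; rewrite /= -!/(@cd_mul R n).
- by rewrite !IH scalerBr.
- by rewrite !IH scalerDr.
- by rewrite cd_conjZ !IH scalerBr.
- by rewrite cd_conjZ !IH scalerDr.
Qed.

Lemma cd_mulN n (x y : cd R n) :
  ((- x) ** y = - (x ** y)) * (x ** (- y) = - (x ** y)).
Proof. by split; rewrite -scaleN1r cd_mulZ scaleN1r. Qed.

Lemma cd_mul0 n (x : cd R n) : (0 ** x = 0) * (x ** 0 = 0).
Proof. by split; rewrite -(scale0r x) cd_mulZ !scale0r. Qed.

Lemma cd_mul1 n (x : cd R n) : (cd_one R n ** x = x) * (x ** cd_one R n = x).
Proof.
have c1 m : cd_conj (cd_one R m) = cd_one R m.
  by elim: m => [//|m IH]; congr pair => /=; rewrite ?IH ?oppr0.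
have c0 m : cd_conj (0 : cd R m) = 0.
  by have := cd_conjZ 0 (0 : cd R m); rewrite !scale0r.
elim: n x => [|n IH] x; first by split; rewrite /= (mul1r, mulr1).
case: x => x x'; split; congr pair; rewrite /= -!/(@cd_mul R n) -?/(@cd_conj R n).
- by rewrite IH cd_mul0 subr0.
- by rewrite IH cd_mul0 addr0.
- by rewrite IH c0 cd_mul0 subr0.
- by rewrite c1 cd_mul0 IH add0r.
Qed.

Lemma cd_mul_embed n (x y : cd R n) :
  cd_mul (n := n.+1) (x, 0) (y, 0) = (x ** y, 0).
Proof.
congr pair; rewrite /= -!/(@cd_mul R n) !cd_mul0 ?addr0 //.
by rewrite subr0.
Qed.

End CayleyDicksonTheory.

Section SliceTheory.
Context (R : realType) (A : hypercomplex).
Local Notation C := (R[i]^o).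
Local Notation AA := (carrier R A).
Local Notation "1A" := (cd_one R (cd_level A)).
Implicit Types (x y I J : AA) (z w : C) (D : set C) (F G : C -> AA * AA).

Lemma carrier_alternative x y : x ** (x ** y) = (x ** x) ** y.
Proof.
case: (A) x y.
  move=> [[a b] [c d]] [[a' b'] [c' d']].
  by congr pair; congr pair => /=; ring.
move=> [[[a b] [c d]] [[e f] [g h]]] [[[a' b'] [c' d']] [[e' f'] [g' h']]].
by congr pair; congr pair; congr pair => /=; ring.
Qed.

Lemma imag_unit_exists : exists I, @imag_units R A I.
Proof.
have ii : (((0, 1), 0) : cd R 2) ** ((0, 1), 0) = - cd_one R 2.
  by congr pair; congr pair => /=; ring.
rewrite /imag_units; case: A; first by exists ((0, 1), 0).
exists (((0, 1), 0), 0); apply: etrans (@cd_mul_embed R 2 _ _) _.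
by rewrite ii; congr pair; rewrite oppr0.
Qed.

Lemma scale1A_inj : injective (fun k : R => k *: 1A).
Proof.
have s1 (k : R) : k *: (1 : R^o) = k by exact: mulr1.
move=> k l; case: (A) => /= /(congr1 (fun q => q.1.1)).
  by move=> h; rewrite -(s1 k) -(s1 l).
by move=> /(congr1 fst) h; rewrite -(s1 k) -(s1 l).
Qed.

Lemma imag_unit_mulK I x : imag_units I -> I ** (I ** x) = - x.
Proof.
move=> hI; rewrite carrier_alternative hI -scaleN1r.
by rewrite cd_mulZ cd_mul1 scaleN1r.
Qed.

Lemma imag_unit_nreal I (k l : R) : imag_units I -> k *: I = l *: 1A -> k = 0.
Proof.
move=> hI E; apply/eqP/negPn/negP => k0.
have {E} EI : I = (l / k) *: 1A.
  by rewrite mulrC -scalerA -E scalerA mulVf // scale1r.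
have : ((l / k) ^+ 2) *: 1A = (- 1) *: 1A.
  by rewrite scaleN1r -hI EI !cd_mulZ cd_mul1 scalerA expr2.
move=> /scale1A_inj E; have := sqr_ge0 (l / k).
by rewrite E oppr_ge0 ler10.
Qed.

Lemma slice_point_eq I J z w : imag_units I -> imag_units J ->
  slice_point I z = slice_point J w ->
  (w = z /\ (complex.Im z = 0 \/ I = J)) \/ (w = z^* /\ I = - J).
Proof.
case: z w => [a b] [c d] hI hJ; rewrite /slice_point /= => E.
have {}E : b *: I = (c - a) *: 1A + d *: J.
  by rewrite scalerBl addrAC -E addrAC subrr add0r.
have sq k K : imag_units K -> (k *: K) ** (k *: K) = (- k ^+ 2) *: 1A.
  by move=> hK; rewrite !cd_mulZ hK !scalerN scalerA scaleNr -expr2.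
have := sq b I hI; rewrite E !cd_mulD; rewrite (sq d J hJ) !cd_mulZ !cd_mul1.
set u := c - a in E *; rewrite !scalerA (mulrC d u) => E2.
have {}E2 : (u * d + u * d) *: J = (- b ^+ 2 - u * u - - d ^+ 2) *: 1A.
  rewrite [RHS]scalerBl scalerBl -E2 scalerDl.
  by rewrite addrAC addrA addrK -!addrA [RHS]addrC !addrA subrK.
have ud : u * d = 0.
  by apply/eqP; rewrite -[_ == 0](mulrn_eq0 _ 2) mulr2n (imag_unit_nreal hJ E2).
have {}E2 : u * u + b ^+ 2 = d ^+ 2.
  move: E2; rewrite ud addr0 scale0r -(scale0r 1A) => /scale1A_inj h.
  by rewrite -[LHS]addr0 h; ring.
have u0 : u = 0.
  move/eqP: ud; rewrite mulf_eq0 => /orP[/eqP//|/eqP d0].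
  apply/eqP; rewrite -sqrf_eq0 expr2; apply/eqP.
  move: E2; rewrite d0 expr0n /= => /eqP; rewrite paddr_eq0 ?sqr_ge0 //.
  by move=> /andP[/eqP].
move: E2 E; rewrite u0 mul0r add0r scale0r add0r => /eqP.
have -> : c = a by apply/eqP; rewrite -subr_eq0 -/u u0.
rewrite eqf_sqr; have [b0|b0] := eqVneq b 0.
  rewrite b0 eq_sym [0 == _]eq_sym oppr_eq0 orbb => /eqP -> _.
  by left; split=> //; left.
move=> /orP[/eqP <-|/eqP bd] E.
- by left; split=> //; right; apply: scalerI E.
- right; split; first by rewrite bd /= opprK.
  by apply: (scalerI b0); rewrite E bd scalerN scaleNr opprK.
Qed.

Lemma slice_point_conj I z : slice_point (- I) (z^* : C) = slice_point I z.
Proof. by case: z => a b; rewrite /slice_point /= scalerN scaleNr opprK. Qed.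

Lemma imag_unitN I : imag_units I -> imag_units (- I).
Proof.
by move=> hI; rewrite /imag_units /= !cd_mulN opprK.
Qed.

Lemma profileK D : conj_invariant D ->
  profile (circularization D : set AA) = D.
Proof.
move=> hD; apply/seteqP; split=> z /=.
  move=> [I hI [w [J [Dw hJ E]]]].
  have [[<- //]|[wz _]] := slice_point_eq hI hJ E.
  by rewrite -[z]conjcK -wz; apply: hD.
by move=> Dz; have [I hI] := imag_unit_exists; exists I => //; exists z, I.
Qed.

Lemma half_sumK (x y : AA) : 2^-1 *: ((x + y) + (x - y)) = x.
Proof.
by rewrite addrACA subrr addr0 scalerDr -scalerDl -div1r -splitr scale1r.
Qed.

Lemma stem_function_unique D F G (f : AA -> AA) :
  stem_function D F -> stem_function D G -> induces D F f -> induces D G f ->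
  forall z, D z -> F z = G z.
Proof.
move=> [_ hD hF] [_ _ hG] iF iG z Dz; have [I hI] := imag_unit_exists.
have e1 : (F z).1 + I ** (F z).2 = (G z).1 + I ** (G z).2.
  by rewrite -iF // -iG.
have e2 : (F z).1 - I ** (F z).2 = (G z).1 - I ** (G z).2.
  have := iF _ _ (hD _ Dz) hI; rewrite (iG _ _ (hD _ Dz) hI) hF // hG //=.
  by rewrite !cd_mulN.
have E1 : (F z).1 = (G z).1.
  rewrite -[LHS](half_sumK _ (I ** (F z).2)) e1 e2.
  exact: half_sumK.
move: e1; rewrite E1 => /addrI /(congr1 (cd_mul I)).
rewrite !imag_unit_mulK // => /oppr_inj E2.
by rewrite [F z]surjective_pairing [G z]surjective_pairing E1 E2.
Qed.

Lemma slice_function_induced D F :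
  stem_function D F -> induces D F (slice_function D F).
Proof.
move=> [_ hD hF] z I Dz hI; rewrite /slice_function.
case: xgetP => [y _ [w [J [Dw hJ E ->]]]|/(_ ((F z).1 + I ** (F z).2))]; last first.
  by case; exists z, I.
have [[-> [z0|-> //]]|[-> ->]] := slice_point_eq hI hJ E; last first.
  by rewrite hF //= !cd_mulN.
have zz : z^* = z by case: z z0 {E Dz} => a b /= ->; rewrite oppr0.
have := hF z Dz; rewrite zz [X in X = _]surjective_pairing => -[F2].
have -> : (F z).2 = 0.
  have : (F z).2 *+ 2 == 0 by rewrite mulr2n {1}F2 addNr.
  rewrite -scaler_nat scaler_eq0 pnatr_eq0 /=; exact: eqP.
by rewrite !cd_mul0.
Qed.

End SliceTheory.

(* Main.v *)
Require Import Defs.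
From mathcomp Require Import all_boot all_order all_algebra.
From mathcomp Require Import polyXY complex.
From mathcomp Require Import boolp classical_sets functions reals.
From mathcomp Require Import constructive_ereal interval_inference.
From mathcomp Require Import topology normedtype derive realfun trigo.
From mathcomp Require Import measure lebesgue_measure lebesgue_integral ftc.
From mathcomp Require Import lebesgue_integral_under.
From mathcomp Require Import ring lra.

(* In a splitting base the stem function is a sum [F = sum_t g_t e_t] with [g_t]
   complex Nash, and [dF/dz = sum_t g_t' e_t], so it suffices that [g'] is complex
   Nash, with continuous derivative, whenever [g] is complex Nash and [C^1].

   Algebra: if [P(w, g(w)) = 0] with [P] of minimal degree in [t], then [P] is coprime
   to [P_t] over [C(z)]. Differentiating, [g(w)] is a common root of [P(w, t)] and
   [P_z(w, t) + s P_t(w, t)] at [s = g'(w)]. These are coprime over [C(z, s)], since for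
   generic [w] only finitely many [s] allow a common root, so a Bezout relation
   provides a non-zero [T] in [C[z, s]] with [T(w, g'(w)) = 0].

   Analysis: [2 pi r g'(w)] is the integral of [g(w + r e^(i t)) e^(- i t)] over a
   period. This formula turns a bound [K |h|] on [g(z + h) - g(z)], or [K |h|^2] on
   [g(z + h) - g(z) - g'(z) h], into a bound of the same kind for [g']. Hence [g'] is
   Lipschitz, then [g] has quadratic Taylor remainders, then so does [g']. *)

Set Implicit Arguments.
Unset Strict Implicit.
Unset Printing Implicit Defensive.

Import Order.TTheory GRing.Theory Num.Theory.
Import numFieldNormedType.Exports.

Local Open Scope ring_scope.

(** * Annihilating polynomials *)

(** In characteristic 0 the integers [0, ..., size p - 1] are distinct, and they are one more than
    the roots that [p] can have. *)
Lemma exists_nonroot (K : numDomainType) (p : {poly K}) :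
  p != 0 -> exists x, p.[x] != 0.
Proof.
move=> p0; pose s : seq K := [seq n%:R | n <- iota 0 (size p)].
have us : uniq s by rewrite map_inj_uniq ?iota_uniq //; exact: mulrIn (oner_neq0 K).
have [rs|/allPn[x _ px]] := boolP (all (root p) s); last by exists x.
have := max_poly_roots p0 rs us.
by rewrite size_map size_iota ltnn.
Qed.

(** Here [g] stands for gcd(p, p'). If [a] were not a root of the cofactor [s], the full power of
    [X - a] in [p] would divide [g], hence p', whose multiplicity at [a] is one less in
    characteristic 0. *)
Lemma root_radical (K : numFieldType) (p s g : {poly K}) (c a : K) :
  p != 0 -> c != 0 -> c *: p = s * g -> g %| p^`() -> root p a -> root s a.
Proof.
move=> p0 c0 cE gp pa; apply/negPn/negP => sa.
have [m [q qa Ep]] := multiplicity_XsubC p a.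
move: qa; rewrite p0 /= => qa.
case: m Ep => [|m Ep]; first by rewrite mulr1 => Ep; rewrite -Ep pa in qa.
have dg : ('X - a%:P) ^+ m.+1 %| g.
  have : ('X - a%:P) ^+ m.+1 %| s * g by rewrite -cE dvdpZr // Ep dvdp_mulIr.
  by rewrite Gauss_dvdpr // coprimep_expl // coprimep_sym coprimep_XsubC.
have := dvdp_trans dg gp; rewrite Ep derivM deriv_exp derivXsubC mul1r exprSr.
rewrite dvdp_addr; last by rewrite -exprSr dvdp_mulIr.
rewrite /= mulrnAr -mulrnAl [_ ^+ m * _]mulrC dvdp_mul2r; last first.
  by rewrite expf_neq0 // polyXsubC_eq0.
rewrite dvdp_XsubCl /root hornerMn mulrn_eq0 /=.
by move=> qa0; rewrite /root qa0 in qa.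
Qed.

Section Bivariate.
Variable K : numClosedFieldType.
Implicit Types (P Q : {poly {poly K}}) (w a s : K).
Local Notation spec w := (map_poly (horner_eval w)).

Lemma horner_spec Q w a : (spec w Q).[a] = Q.[a, w].
Proof. by rewrite -[X in _.[X]](hornerC a w) [LHS](horner_map (horner_eval w) Q). Qed.

(** Dividing [Q] by its gcd with its derivative lowers the degree and, for generic [w], keeps the
    roots by [root_radical]. Strong induction on the degree then ends at a coprime pair. *)
Lemma coprime_annihilant (G : K -> K -> Prop) Q : Q != 0 ->
  (forall w a, G w a -> Q.[a, w] = 0) ->
  exists Q', [/\ Q' != 0, (forall w a, G w a -> Q'.[a, w] = 0)
               & coprimep Q' Q'^`()].
Proof.
have [n] := ubnP (size Q); elim: n Q => // n IH Q /ltnSE-szQ Q0 QG.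
have [cQ|ncQ] := boolP (coprimep Q Q^`()); first by exists Q.
set D := gcdp Q Q^`() in ncQ.
have [[c S] /= c0 cE] := Pdiv.Idomain.dvdpP _ _ (dvdp_gcdl Q Q^`()).
have [[c' S'] /= c'0 c'E] := Pdiv.Idomain.dvdpP _ _ (dvdp_gcdr Q Q^`()).
rewrite -/D in cE c'E.
have SD0 : S * D != 0 by rewrite -cE scale_poly_eq0 negb_or c0.
have [S0 D0] : S != 0 /\ D != 0 by apply/andP; rewrite -negb_or -mulf_eq0.
have k0 : c * c' * lead_coef Q != 0 by rewrite !mulf_neq0 ?lead_coef_eq0.
(* The scalar factor makes the new polynomial vanish identically at the [w] where one of the two
   pseudo-divisions or the leading coefficient degenerates; at all other [w] the specialized
   relations fit [root_radical]. *)
apply: (IH ((c * c' * lead_coef Q) *: S)).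
- rewrite size_scale //; apply: leq_trans szQ.
  have := size_mul S0 D0; rewrite -cE size_scale // => ->.
  have : (1 < size D)%N.
    by rewrite ltn_neqAle eq_sym size_poly_gt0 D0 andbT -coprimep_def.
  by case: (size D) => [|[|d]] // _; rewrite !addnS /= ltnS leq_addr.
- by rewrite scale_poly_eq0 negb_or k0.
move=> w a Gwa; rewrite hornerZ hornerM !hornerM.
have [->|cw] := eqVneq c.[w] 0; first by rewrite !mul0r.
have [->|c'w] := eqVneq c'.[w] 0; first by rewrite mulr0 !mul0r.
have [->|lw] := eqVneq (lead_coef Q).[w] 0; first by rewrite mulr0 mul0r.
suff /rootP : root (spec w S) a by rewrite horner_spec => ->; rewrite mulr0.
apply: (@root_radical _ (spec w Q) _ (spec w D) c.[w]) => //.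
- apply/eqP => /polyP /(_ (size Q).-1); rewrite coef_map coef0 => /eqP.
  by apply/negP.
- by have := congr1 (spec w) cE; rewrite map_polyZ rmorphM.
- have := congr1 (spec w) c'E; rewrite map_polyZ rmorphM /= -deriv_map.
  by move=> E; rewrite -(dvdpZr _ _ c'w) E dvdp_mulIr.
- by apply/rootP; rewrite horner_spec QG.
Qed.

Lemma bezout_scalar (B : idomainType) (p q : {poly B}) : coprimep p q ->
  exists u v c, c != 0 /\ u * p + v * q = c%:P.
Proof.
move=> /Bezout_coprimepP[[u v] /= /eqpP[[c1 c2] /= /andP[c10 c20] E]].
exists (c1%:P * u), (c1%:P * v), c2; split=> //.
by rewrite -!mulrA -mulrDr mul_polyC E alg_polyC.
Qed.

Lemma slope_annihilant Q : Q != 0 -> coprimep Q Q^`() ->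
  exists2 T : {poly {poly K}}, T != 0 & forall w a s, Q.[a, w] = 0 ->
    (map_poly deriv Q).[a, w] + s * Q^`().[a, w] = 0 -> T.[s, w] = 0.
Proof.
(* [lift] adjoins the slope variable: polynomials in t, with coefficients in s over polynomials in
   w. [S] is Q_z + s Q_t, and [ev w s] evaluates the coefficients. *)
move=> Q0 cQ; pose lift := map_poly (polyC : {poly K} -> {poly {poly K}}).
pose S := lift (map_poly deriv Q) + 'X%:P * lift Q^`().
pose ev w s : {rmorphism {poly {poly K}} -> K} := horner_eval w \o horner_eval s%:P.
have ev_lift w s p : map_poly (ev w s) (lift p) = spec w p.
  by rewrite -map_poly_comp; apply: eq_map_poly => b /=; rewrite /horner_eval hornerC.
have ev_S w s : map_poly (ev w s) S = spec w (map_poly deriv Q) + s *: (spec w Q)^`().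
  rewrite rmorphD rmorphM /= !ev_lift map_polyC /= -deriv_map -mul_polyC.
  by rewrite /horner_eval hornerX hornerC.
have [/bezout_scalar[u [v [T [T0 E]]]]|ncS] := boolP (coprimep (lift Q) S).
  exists T => // w a s Qa Sa; have := congr1 (map_poly (ev w s)) E.
  rewrite rmorphD !rmorphM /= ev_lift ev_S map_polyC => /(congr1 (horner^~ a)).
  rewrite !hornerE deriv_map !horner_spec Qa Sa !mulr0 addr0.
  by move=> ->.
rewrite coprimep_def in ncS; set D := gcdp _ _ in ncS.
have D0 : D != 0 by rewrite gcdp_eq0 negb_and map_polyC_eq0 Q0.
have szD : (1 < size D)%N.
  by rewrite ltn_neqAle eq_sym size_poly_gt0 D0 andbT.
have [[a A] /= a0 aE] := Pdiv.Idomain.dvdpP _ _ (dvdp_gcdl (lift Q) S).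
have [[b B] /= b0 bE] := Pdiv.Idomain.dvdpP _ _ (dvdp_gcdr (lift Q) S).
rewrite -/D in aE bE.
have [u [v [c [c0 cE]]]] := bezout_scalar cQ.
pose h := a * b * lead_coef D.
have h0 : h != 0 by rewrite !mulf_neq0 ?lead_coef_eq0.
have [w] : exists w, (lead_coef h * c * lead_coef Q).[w] != 0.
  by apply: exists_nonroot; rewrite !mulf_neq0 ?lead_coef_eq0.
rewrite !hornerM !mulf_eq0 !negb_or => /andP[/andP[hw cw] Qw].
have neq0 (p : {poly {poly K}}) : (lead_coef p).[w] != 0 -> spec w p != 0.
  move=> pw; apply/eqP => /polyP /(_ (size p).-1); rewrite coef_map coef0.
  by move/eqP; apply/negP.
have [r rE] := closed_field_poly_normal (spec w Q).
have rP t : (t \in r) = (Q.[t, w] == 0).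
  rewrite -horner_spec rE hornerZ mulf_eq0 lead_coef_eq0 (negbTE (neq0 _ Qw)) /=.
  by rewrite -root_prod_XsubC.
(* As a polynomial in s, [k t] is the value of [S] at the root [t]. Its coefficient of s is non-zero
   by the choice of [w], so each of the finitely many roots [t] excludes a single slope. *)
pose k t := ((map_poly deriv Q).[t, w])%:P + Q^`().[t, w] *: 'X.
have [s] : exists s, (spec w h * \prod_(t <- r) k t).[s] != 0.
  apply: exists_nonroot; rewrite mulf_neq0 ?neq0 // prodf_seq_neq0.
  apply/allP => t; rewrite rP => /eqP Qt /=; apply/eqP => /polyP /(_ 1%N).
  rewrite coefD coefC coefZ coefX coef0 mulr1 add0r => Q't.
  move: cw; have := congr1 (fun p => p.[t, w]) cE.
  by rewrite !hornerE Qt Q't !mulr0 addr0 => <-; rewrite eqxx.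
rewrite hornerM mulf_eq0 negb_or horner_prod prodf_seq_neq0 => /andP[hs /allP ks].
have {hs} : ev w s h != 0 by rewrite /= /horner_eval -horner_spec.
rewrite !rmorphM !mulf_eq0 !negb_or => /andP[/andP[aws bws] Dws].
(* The leading coefficient of [D] survives the specialization, so a root exists over the
   algebraically closed field; it is a common root of the specialized [Q] and [S]. *)
have [t Dt] : exists t, root (map_poly (ev w s) D) t.
  by apply/closed_rootP; rewrite size_map_poly_id0 // neq_ltn szD orbT.
have Qt : Q.[t, w] = 0.
  have := congr1 (map_poly (ev w s)) aE.
  rewrite map_polyZ rmorphM /= ev_lift => /(congr1 (horner^~ t)).
  rewrite hornerZ hornerM (rootP Dt) mulr0 horner_spec => /eqP.
  by rewrite mulf_eq0 (negbTE aws) => /eqP.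
have := ks t; rewrite rP Qt eqxx => /(_ isT) /negP[].
have := congr1 (map_poly (ev w s)) bE.
rewrite map_polyZ rmorphM /= ev_S => /(congr1 (horner^~ t)).
rewrite hornerZ hornerM (rootP Dt) mulr0 => /eqP.
rewrite mulf_eq0 (negbTE bws) /= hornerD hornerZ deriv_map !horner_spec.
by rewrite /k hornerD hornerC hornerZ hornerX [s * _]mulrC.
Qed.
End Bivariate.

Local Open Scope classical_set_scope.
Local Open Scope ring_scope.
Local Open Scope complex_scope.

(** * Complex differentiability *)

(* Caratheodory form of the derivative. *)
Lemma is_derive_slope (K : numFieldType) (V : normedModType K) (f : K^o -> V)
    (a : K^o) (d : V) : is_derive a (1 : K^o) f d ->
  exists phi : K^o -> V, [/\ phi a = d, phi z @[z --> a] --> d &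
    forall z, f z - f a = (z - a) *: phi z].
Proof.
move=> [/[swap] <- /cvgrPdist_lt fd].
exists (fun z => if z == a then 'D_1 f a else (z - a)^-1 *: (f z - f a)); split.
- by rewrite eqxx.
- apply/(@cvgrPdist_lt _ _ _ (nbhs a) (nbhs_filter a)) => e e0.
  have /nbhs_ballP[r /= r0 rP] := fd e e0.
  apply/nbhs_ballP; exists r => //= z az; case: ifPn => [_|za].
    by rewrite subrr normr0.
  have := rP (z - a); rewrite /ball /= sub0r normrN distrC => /(_ az).
  by rewrite subr_eq0 => /(_ za); rewrite /= scaler1 subrK.
- move=> z; case: ifPn => [/eqP ->|za]; first by rewrite !subrr scale0r.
  by rewrite scalerA divff ?subr_eq0 // scale1r.
Qed.

Lemma slope_is_derive (K : numFieldType) (V : normedModType K) (f : K^o -> V)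
    (phi : K^o -> V) (a : K^o) (d : V) : phi z @[z --> a] --> d ->
  (forall z, f z - f a = (z - a) *: phi z) -> is_derive a (1 : K^o) f d.
Proof.
move=> phid fE.
have fd : (fun h => h^-1 *: (f (h *: 1 + a) - f a)) @ 0^' --> d.
  apply/cvgrPdist_lt => e e0.
  move/cvgrPdist_lt : phid => /(_ e e0) /nbhs_ballP[r /= r0 rP].
  apply/nbhs_ballP; exists r => //= h; rewrite /ball /= sub0r normrN => hr h0.
  rewrite fE addrK scaler1 scalerA mulVf // scale1r; apply: rP.
  by rewrite /ball /= opprD addrCA subrr addr0 normrN.
by split; [apply/cvg_ex; exists d|apply/cvg_lim].
Qed.

Lemma is_derive_cvg (K : numFieldType) (V : normedModType K) (f : K^o -> V)
    (a : K^o) (d : V) : is_derive a (1 : K^o) f d -> f z @[z --> a] --> f a.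
Proof.
by move=> [df _]; apply: differentiable_continuous; apply/derivable1_diffP.
Qed.

(** * The real-valued modulus, and complex functions along real curves *)

Section ComplexNorm.
Variable R : realType.
Local Notation C := (R[i]^o).
Local Notation Re := complex.Re.
Local Notation Im := complex.Im.
Implicit Types (z w : C) (e r : R).

(** The norm on [R[i]^o] is itself an element of [R[i]]; real estimates need its real value. *)
Definition cnorm z : R := Re `|z|.

Lemma cnormE z : `|z| = (cnorm z)%:C.
Proof. by rewrite /cnorm normc_def. Qed.

Lemma cnorm_ge0 z : 0 <= cnorm z.
Proof. by rewrite -lecR -cnormE; exact: (normr_ge0 z). Qed.

Lemma cnormM z w : cnorm (z * w) = cnorm z * cnorm w.
Proof.
suff : (cnorm (z * w))%:C = (cnorm z * cnorm w)%:C by case.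
by rewrite rmorphM /= -!cnormE; exact: normrM.
Qed.

Lemma cnormD z w : cnorm (z + w) <= cnorm z + cnorm w.
Proof. by rewrite -lecR rmorphD /= -!cnormE; exact: ler_normD. Qed.

Lemma cnormN z : cnorm (- z) = cnorm z.
Proof. by rewrite /cnorm normrN. Qed.

Lemma cnorm_distC z w : cnorm (z - w) = cnorm (w - z).
Proof. by rewrite -cnormN opprB. Qed.

Lemma cnorm0 : cnorm 0 = 0.
Proof. by rewrite /cnorm normr0. Qed.

Lemma cnorm0_eq0 z : cnorm z = 0 -> z = 0.
Proof. by move=> z0; apply/normr0_eq0; rewrite cnormE z0. Qed.

Lemma cnormC r : cnorm r%:C = `|r|.
Proof. by rewrite /cnorm normc_def /= expr0n addr0 sqrtr_sqr. Qed.

Lemma Re_le_cnorm z : `|Re z| <= cnorm z.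
Proof. by rewrite -lecR -cnormE normc_ge_Re. Qed.

Lemma cnormI : cnorm 'i = 1.
Proof. by rewrite /cnorm normc_def /= expr0n add0r expr1n sqrtr1. Qed.

Lemma Im_le_cnorm z : `|Im z| <= cnorm z.
Proof.
have -> : Im z = - Re (z * 'i) by rewrite ReiNIm opprK.
by rewrite normrN (le_trans (Re_le_cnorm _)) // cnormM cnormI mulr1.
Qed.

Lemma cnorm_le z : cnorm z <= `|Re z| + `|Im z|.
Proof.
rewrite {1}(complexE z) (le_trans (cnormD _ _)) //.
by rewrite cnormM cnormI mul1r !cnormC.
Qed.

Lemma ltc0P (e : R[i]) : 0 < e -> exists2 r : R, 0 < r & e = r%:C.
Proof.
by case: e => a b; rewrite ltcE /= => /andP[/eqP -> a0]; exists a.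
Qed.

Lemma nbhsCP z (P : set C) :
  nbhs z P <-> exists2 e : R, 0 < e & forall w, cnorm (w - z) < e -> P w.
Proof.
split.
  move=> /nbhs_ballP[_/posnumP[e]] /=.
  have [r r0 ->] := ltc0P (gt0 e) => zP; exists r => // w wz.
  by apply: zP; rewrite -ball_normE /= distrC cnormE ltcR.
move=> [e e0 eP]; apply/nbhs_ballP; exists e%:C; first by rewrite /= ltcR.
by move=> w; rewrite -ball_normE /= distrC cnormE ltcR; exact: eP.
Qed.

Lemma cvgCP (T : Type) (F : set_system T) (f : T -> C) z : Filter F ->
  f @ F --> z <-> forall e : R, 0 < e -> \forall t \near F, cnorm (f t - z) < e.
Proof.
move=> FF; split=> [/cvgrPdist_lt fz e e0|fz].
  have /fz : (0 : R[i]) < e%:C by rewrite ltcR.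
  by apply: filterS => t; rewrite distrC cnormE ltcR.
apply/cvgrPdist_lt => _/ltc0P[e e0 ->]; apply: filterS (fz e e0) => t.
by rewrite distrC cnormE ltcR.
Qed.

Lemma cvg_complex (T : Type) (F : set_system T) (x y : T -> R) (a b : R) :
  Filter F -> x @ F --> a -> y @ F --> b ->
  (fun t => (x t +i* y t : C)) @ F --> (a +i* b : C).
Proof.
move=> FF /cvgrPdist_lt xa /cvgrPdist_lt yb; apply/cvgCP => e e0.
have e2 : 0 < e / 2 by rewrite divr_gt0.
near=> t; apply: le_lt_trans (cnorm_le _) _ => /=; rewrite [e]splitr ltrD //.
- by rewrite distrC; near: t; exact: xa.
- by rewrite distrC; near: t; exact: yb.
Unshelve. all: by end_near. Qed.

Lemma cvg_Re (T : Type) (F : set_system T) (f : T -> C) z :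
  Filter F -> f @ F --> z -> (fun t => Re (f t)) @ F --> Re z.
Proof.
move=> FF /cvgCP fz; apply/cvgrPdist_lt => e e0; apply: filterS (fz e e0) => t.
by rewrite distrC -raddfB; apply: le_lt_trans; exact: Re_le_cnorm.
Qed.

Lemma cvg_Im (T : Type) (F : set_system T) (f : T -> C) z :
  Filter F -> f @ F --> z -> (fun t => Im (f t)) @ F --> Im z.
Proof.
move=> FF /cvgCP fz; apply/cvgrPdist_lt => e e0; apply: filterS (fz e e0) => t.
by rewrite distrC -raddfB; apply: le_lt_trans; exact: Im_le_cnorm.
Qed.

(** A chain rule across two scalar fields: [g] is differentiated over [R[i]] and the curve over [R].
    The product of the Caratheodory slopes [phi] and [u +i* v] is a slope of the composite. *)
Lemma is_derive_Re_curve (g : C -> C) (w d : C) (x y : R -> R) (t x' y' : R) :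
  is_derive (w : C) (1 : C) g d -> is_derive t 1 x x' -> is_derive t 1 y y' ->
  x t +i* y t = w ->
  is_derive t 1 (fun s => Re (g (x s +i* y s))) (Re (d * (x' +i* y'))).
Proof.
move=> /(@is_derive_slope R[i]) [phi [phiw phid gE]] dx dy gt.
have [u [ut ud xE]] := is_derive_slope dx.
have [v [vt vd yE]] := is_derive_slope dy.
apply: (@slope_is_derive _ _ _ (fun s => Re (phi (x s +i* y s) * (u s +i* v s)))).
  apply: cvg_Re; apply: (@cvgM R[i]).
    apply: cvg_comp phid; rewrite -gt; apply: cvg_complex; exact: is_derive_cvg.
  exact: cvg_complex.
move=> s; rewrite -raddfB gt gE -gt.
have -> : (x s +i* y s) - (x t +i* y t) = (s - t)%:C * (u s +i* v s).
  have -> : (s - t)%:C * (u s +i* v s) = ((s - t) * u s) +i* ((s - t) * v s).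
    by simpc.
  by rewrite -[(s - t) * u s]xE -[(s - t) * v s]yE; simpc.
rewrite /GRing.scale /= -mulrA [X in _ * X]mulrC.
by case: (phi _ * _) => a b; simpc.
Qed.

Lemma is_derive_Im_curve (g : C -> C) (w d : C) (x y : R -> R) (t x' y' : R) :
  is_derive (w : C) (1 : C) g d -> is_derive t 1 x x' -> is_derive t 1 y y' ->
  x t +i* y t = w ->
  is_derive t 1 (fun s => Im (g (x s +i* y s))) (Im (d * (x' +i* y'))).
Proof.
move=> dg dx dy gt.
have ImE (z : C) : Im z = Re (- 'i * z).
  by rewrite mulrC mulrN raddfN /= ReiNIm opprK.
rewrite ImE mulrA; under eq_fun do rewrite ImE.
by apply: (is_derive_Re_curve _ dx dy gt); exact: is_deriveZ.
Qed.
End ComplexNorm.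

(** * Mean value estimates on segments *)

Section MeanValue.
Variable R : realType.
Local Notation C := (R[i]^o).
Local Notation Re := complex.Re.
Local Notation Im := complex.Im.
Implicit Types (z w h a : C) (g dg : C -> C).

Lemma ImE z : Im z = Re (- 'i * z).
Proof. by rewrite mulrC mulrN raddfN /= ReiNIm opprK. Qed.

(** The real mean value theorem on [[0, 1]] for [f s = Re (g (z + s h)) - s Re (a h)], whose
    derivative is the real part of [(dg - a) h]. *)
Lemma mean_value_Re g dg z h a (K : R) :
  (forall s : R, 0 <= s <= 1 ->
    is_derive (z + s%:C * h : C) (1 : C) g (dg (z + s%:C * h))) ->
  (forall s : R, 0 <= s <= 1 -> cnorm (dg (z + s%:C * h) - a) <= K) ->
  `|Re (g (z + h) - g z - a * h)| <= K * cnorm h.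
Proof.
move=> gd dgK.
pose x s : R := Re z + s * Re h; pose y s : R := Im z + s * Im h.
have xyE s : x s +i* y s = z + s%:C * h.
  by rewrite /x /y; case: (z) => p q; case: (h) => u v; simpc.
pose f : R -> R :=
  (fun s : R => Re (g (x s +i* y s)) : R) - (fun s : R => s * Re (a * h)).
have dlin (u v s : R) : is_derive s 1 (fun s => u + s * v) v.
  apply: (@slope_is_derive _ _ _ (cst v)); first exact: cvg_cst.
  by move=> q; rewrite /GRing.scale /=; ring.
have fd (s : R) : 0 <= s <= 1 -> is_derive s 1 f (Re ((dg (z + s%:C * h) - a) * h)).
  move=> s01; rewrite mulrBl raddfB /=; apply: is_deriveB.
    have hE : h = Re h +i* Im h by case: (h).
    rewrite [X in Re (_ * X)]hE.
    exact: is_derive_Re_curve (gd s s01) (dlin _ _ s) (dlin _ _ s) (xyE s).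
  have := dlin 0 (Re (a * h)) s; under eq_fun do rewrite add0r; exact.
have [|c c01 E] := @MVT_segment _ f _ 0 1 ler01
    (fun s s01 => fd s (subset_itv_oo_cc s01)).
  by apply: derivable_within_continuous => s /= s01; have [] := fd s s01.
have -> : Re (g (z + h) - g z - a * h) = f 1 - f 0.
  rewrite /f !fctE !xyE !mul1r mul0r mul0r subr0 !raddfB /= addr0.
  by rewrite addrAC.
rewrite E subr0 mulr1 (le_trans (Re_le_cnorm _)) // cnormM ler_wpM2r ?cnorm_ge0 //.
exact: dgK.
Qed.

(** Complex estimates are reduced to real parts, the imaginary part being a real part after rotation
    by [- 'i]. The two parts are bounded separately, which costs a factor 2. *)
Lemma cnorm_le_Re (K : R) z : `|Re z| <= K -> `|Re (- 'i * z)| <= K ->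
  cnorm z <= 2 * K.
Proof.
move=> zR zI; rewrite (le_trans (cnorm_le _)) // mulr_natl mulr2n lerD //.
by rewrite ImE.
Qed.

Lemma mean_value g dg z h a (K : R) :
  (forall s : R, 0 <= s <= 1 ->
    is_derive (z + s%:C * h : C) (1 : C) g (dg (z + s%:C * h))) ->
  (forall s : R, 0 <= s <= 1 -> cnorm (dg (z + s%:C * h) - a) <= K) ->
  cnorm (g (z + h) - g z - a * h) <= 2 * (K * cnorm h).
Proof.
move=> gd dgK; apply: cnorm_le_Re; first exact: (@mean_value_Re _ dg).
rewrite !mulrBr mulrA.
apply: (@mean_value_Re (fun z => - 'i * g z) (fun z => - 'i * dg z)) => s s01.
  exact/is_deriveZ/gd.
by rewrite -mulrBr cnormM cnormN cnormI mul1r; exact: dgK.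
Qed.

Definition cdisc (w : C) (r : R) : set C := [set z | cnorm (z - w) < r].

(** Convexity of discs. The strict inequality is drawn from the endpoint weighted by [s], so [s = 0]
    is treated apart. *)
Lemma cdisc_segment (w z h : C) (r s : R) : 0 <= s <= 1 -> cdisc w r z ->
  cdisc w r (z + h) -> cdisc w r (z + s%:C * h).
Proof.
rewrite /cdisc /= => /andP[s0 s1] zr zhr.
have -> : z + s%:C * h - w = (1 - s)%:C * (z - w) + s%:C * (z + h - w).
  by rewrite rmorphB /=; ring.
apply: le_lt_trans (cnormD _ _) _; rewrite !cnormM !cnormC !ger0_norm ?subr_ge0 //.
have r_ := cnorm_ge0 (z - w).
have [->|sn0] := eqVneq s 0; first by rewrite subr0 mul1r mul0r addr0.
have -> : r = (1 - s) * r + s * r by ring.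
rewrite ler_ltD // ?ler_wpM2l ?subr_ge0 //; first exact: ltW.
by rewrite ltr_pM2l // lt_neqAle eq_sym sn0.
Qed.

End MeanValue.

(** * The derivative as a mean over circles *)

Section PeriodIntegral.
Variable R : realType.
Implicit Types (p q : R -> R).
Local Notation mu := (@lebesgue_measure R).

Definition period_int p : R := \int[mu]_(t in `[0, pi *+ 2]) p t.

Let T_gt0 : (0 : R) < pi *+ 2. Proof. by rewrite pmulrn_rgt0 // pi_gt0. Qed.

Lemma period_integrable p : continuous p ->
  mu.-integrable `[0, pi *+ 2] (EFin \o p).
Proof.
move=> cp; apply: continuous_compact_integrable; first exact: segment_compact.
exact: continuous_subspaceT.
Qed.

Lemma period_int_cst (k : R) : period_int (cst k) = pi *+ 2 * k.
Proof.
rewrite /period_int Rintegral_cst //= lebesgue_measure_itv /= lte_fin T_gt0.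
by rewrite -EFinB /= subr0 mulrC.
Qed.

Lemma period_intB p q : continuous p -> continuous q ->
  period_int (fun t => p t - q t) = period_int p - period_int q.
Proof. by move=> cp cq; apply: RintegralB => //; exact: period_integrable. Qed.

Lemma period_intZ (k : R) p : continuous p ->
  period_int (fun t => k * p t) = k * period_int p.
Proof. by move=> cp; apply: RintegralZl => //; exact: period_integrable. Qed.

Lemma period_int_le p (K : R) : continuous p -> (forall t, `|p t| <= K) ->
  `|period_int p| <= pi *+ 2 * K.
Proof.
move=> cp pK; rewrite -period_int_cst.
apply: le_trans (le_normr_Rintegral _ (period_integrable cp)) _ => //.
apply: le_Rintegral => //.
- by apply: period_integrable => t; apply: cvg_norm; exact: cp.
- by apply: period_integrable => t; exact: cvg_cst.
Qed.

Lemma period_int_derive p q : continuous q -> (forall t, is_derive t (1 : R) p (q t)) ->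
  period_int q = p (pi *+ 2) - p 0.
Proof.
move=> cq pq; have cp : continuous p.
  by move=> t; exact: (is_derive_cvg (pq t)).
rewrite /period_int /Rintegral (@continuous_FTC2 _ q p) //.
- exact: continuous_subspaceT.
- split; first by move=> t _; have [] := pq t.
  + by apply: cvg_at_right_filter; exact: cp.
  + by apply: cvg_at_left_filter; exact: cp.
- by move=> t _; rewrite derive1E; have [_] := pq t.
Qed.

End PeriodIntegral.

(** * Radial and angular derivatives on circles *)

Section CircleMean.
Variable R : realType.
Local Notation C := (R[i]^o).
Local Notation Re := complex.Re.
Local Notation Im := complex.Im.
Implicit Types (z w h a : C) (g dg : C -> C) (r t : R).

(** The point w + r e^(i t), written in coordinates to fit the derivative rules along curves. *)
Definition circle_pt w r t : C := (Re w + r * cos t) +i* (Im w + r * sin t).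

(* Real part of [g * e^(- i t)] *)
Definition radial g w r t : R :=
  Re (g (circle_pt w r t)) * cos t + Im (g (circle_pt w r t)) * sin t.

Lemma circle_pt_sub w r t : circle_pt w r t - w = r%:C * (cos t +i* sin t).
Proof.
by case: w => p q; rewrite /circle_pt; simpc => /=; rewrite ![_ + r * _]addrC !addrK.
Qed.

Lemma cnorm_circle w r t : cnorm (circle_pt w r t - w) = `|r|.
Proof.
rewrite circle_pt_sub cnormM cnormC.
by rewrite /cnorm normc_def /= cos2Dsin2 sqrtr1 mulr1.
Qed.

Lemma is_derive_circle_r w r t :
  is_derive r (1 : R) (fun s => Re w + s * cos t) (cos t) *
  is_derive r (1 : R) (fun s => Im w + s * sin t) (sin t).
Proof.
by split; apply: (@slope_is_derive _ _ _ (cst _)); try exact: cvg_cst;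
  move=> s; rewrite /GRing.scale /=; ring.
Qed.

Lemma is_derive_circle_t w r t :
  is_derive t (1 : R) (fun s => Re w + r * cos s) (- (r * sin t)) *
  is_derive t (1 : R) (fun s => Im w + r * sin s) (r * cos t).
Proof.
split.
  have := is_deriveD (is_derive_cst (Re w) t (1 : R)) (is_deriveZ r (is_derive_cos t)).
  by rewrite add0r /GRing.scale /= mulrN.
have := is_deriveD (is_derive_cst (Im w) t (1 : R)) (is_deriveZ r (is_derive_sin t)).
by rewrite add0r.
Qed.

Lemma continuous_circle w r : continuous (circle_pt w r).
Proof.
move=> t; have [dx dy] := is_derive_circle_t w r t.
apply: cvg_complex; [exact: is_derive_cvg dx | exact: is_derive_cvg dy].
Qed.

Lemma is_derive_prod (p q : R -> R) (t dp dq : R) :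
  is_derive t (1 : R) p dp -> is_derive t (1 : R) q dq ->
  is_derive t (1 : R) (fun s => p s * q s) (dp * q t + p t * dq).
Proof.
move=> hp hq; have := is_deriveM hp hq.
by rewrite addrC [q t *: _]mulrC.
Qed.

(** Along the radius at angle [t], [g] has derivative [d e^(i t)], and the factor e^(- i t) in
    [radial] undoes the rotation. *)
Lemma is_derive_radial g w r t d : is_derive (circle_pt w r t) (1 : C) g d ->
  is_derive r (1 : R) (fun s => radial g w s t) (Re d).
Proof.
move=> gd; have [dx dy] := is_derive_circle_r w r t.
have := is_deriveD
  (is_derive_prod (is_derive_Re_curve gd dx dy erefl) (is_derive_cst (cos t) r (1 : R)))
  (is_derive_prod (is_derive_Im_curve gd dx dy erefl) (is_derive_cst (sin t) r (1 : R))).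
rewrite !mulr0 !addr0; congr is_derive.
have := cos2Dsin2 t; case: (d) => a b; simpc => /= cs.
by rewrite -[RHS]mulr1 -cs; ring.
Qed.

(* The function of [s] is [Im (g * e^(- i s))]. *)
Lemma is_derive_angular g w r t d : is_derive (circle_pt w r t) (1 : C) g d ->
  is_derive t (1 : R)
    (fun s => Im (g (circle_pt w r s)) * cos s - Re (g (circle_pt w r s)) * sin s)
    (r * Re d - radial g w r t).
Proof.
move=> gd; have [dx dy] := is_derive_circle_t w r t.
have := is_deriveB
  (is_derive_prod (is_derive_Im_curve gd dx dy erefl) (is_derive_cos t))
  (is_derive_prod (is_derive_Re_curve gd dx dy erefl) (is_derive_sin t)).
congr is_derive; rewrite /radial -/(circle_pt w r t).
case: (g _) => u v; have := cos2Dsin2 t; case: (d) => a b; simpc => /= cs.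
by rewrite -[r * a]mulr1 -cs; ring.
Qed.

Lemma continuous_Re_circle (h : C -> C) w r :
  (forall t, {for circle_pt w r t, continuous h}) ->
  continuous (fun t => Re (h (circle_pt w r t))).
Proof.
move=> ch t; apply: cvg_Re; apply: cvg_comp; last exact: ch.
exact: continuous_circle.
Qed.

Lemma continuous_Im_circle (h : C -> C) w r :
  (forall t, {for circle_pt w r t, continuous h}) ->
  continuous (fun t => Im (h (circle_pt w r t))).
Proof.
move=> ch t; apply: cvg_Im; apply: cvg_comp; last exact: ch.
exact: continuous_circle.
Qed.

Lemma continuous_radial (h : C -> C) w r :
  (forall t, {for circle_pt w r t, continuous h}) -> continuous (radial h w r).
Proof.
move=> ch t; apply: cvgD; apply: cvgM.
- exact: continuous_Re_circle.
- exact: continuous_cos.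
- exact: continuous_Im_circle.
- exact: continuous_sin.
Qed.

Section MeanFormula.
Variables (g dg : C -> C) (w : C) (r M : R).
Hypothesis g_hol : forall z, cdisc w r z -> is_derive z (1 : C) g (dg z).
Hypothesis dg_cont : forall z, cdisc w r z -> {for z, continuous dg}.
Hypothesis dg_bound : forall z, cdisc w r z -> cnorm (dg z) <= M.

Let circle_in s t : `|s| < r -> cdisc w r (circle_pt w s t).
Proof. by rewrite /cdisc /= cnorm_circle. Qed.

Let g_cont z : cdisc w r z -> {for z, continuous g}.
Proof. by move=> /g_hol /(@is_derive_cvg R[i]). Qed.

(** The integral of the mean formula and the integral of Re g' over the same circle. The formula
    will follow from the two relations chi = s N and chi' = N. *)
Let chi s := period_int (radial g w s).
Let N s := period_int (fun t => Re (dg (circle_pt w s t))).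

(** By [is_derive_angular], the difference of the two integrands is the derivative of a function
    with equal values at 0 and 2 pi. *)
Let chiE s : `|s| < r -> chi s = s * N s.
Proof.
move=> sr; have cR : continuous (fun t => Re (dg (circle_pt w s t))).
  by apply: continuous_Re_circle => t; exact/dg_cont/circle_in.
have cg : continuous (radial g w s).
  by apply: continuous_radial => t; exact/g_cont/circle_in.
apply/esym/eqP; rewrite -subr_eq0 -period_intZ // -period_intB //; last first.
  by move=> t; apply: cvgM; [exact: cvg_cst|exact: cR].
pose p t := Im (g (circle_pt w s t)) * cos t - Re (g (circle_pt w s t)) * sin t.
pose q t := s * Re (dg (circle_pt w s t)) - radial g w s t.
have cq : continuous q.
  by move=> t; apply: cvgB; [apply: cvgM; [exact: cvg_cst|exact: cR]|exact: cg].
have pq t : is_derive t (1 : R) p (q t).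
  by apply: is_derive_angular; exact/g_hol/circle_in.
rewrite -/q (period_int_derive cq pq).
by rewrite /p /circle_pt cos2pi sin2pi cos0 sin0 subrr.
Qed.

(** Differentiation under the integral sign: by [is_derive_radial] the partial derivative in the
    radius is Re g', dominated by the constant [M]. *)
Let is_derive_chi s : `|s| < r -> is_derive s (1 : R) chi (N s).
Proof.
move=> sr; have Ir x : `]-r, r[%classic x -> `|x| < r.
  by rewrite /= in_itv /= ltr_norml.
have Is : `]-r, r[%classic s by rewrite /= in_itv /= -ltr_norml.
have d1E x t : `]-r, r[%classic x ->
    partial1of2 (radial g w) x t = Re (dg (circle_pt w x t)).
  move=> /Ir xr; rewrite partial1of2E.
  by have [_] := is_derive_radial (g_hol (circle_in t xr)).
have M0 : 0 <= M.
  by apply: le_trans (dg_bound (circle_in 0 sr)); exact: cnorm_ge0.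
have int_chi x : `]-r, r[%classic x ->
    (@lebesgue_measure R).-integrable `[0, pi *+ 2] (EFin \o radial g w x).
  move=> /Ir xr; apply: period_integrable.
  by apply: continuous_radial => t; exact/g_cont/circle_in.
have der x t : `]-r, r[%classic x -> `[0, pi *+ 2]%classic t ->
    derivable (radial g w ^~ t) x (1 : R).
  by move=> /Ir xr _; have [] := is_derive_radial (g_hol (circle_in t xr)).
have bnd x t : `]-r, r[%classic x -> `[0, pi *+ 2]%classic t ->
    `|partial1of2 (radial g w) x t| <= cst M t.
  move=> Ix _; rewrite d1E //; apply: le_trans (Re_le_cnorm _) _.
  exact/dg_bound/circle_in/Ir.
have intM : (@lebesgue_measure R).-integrable `[0, pi *+ 2] (EFin \o cst M).
  by apply: period_integrable => t; exact: cvg_cst.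
have mT : measurable (`[0, pi *+ 2]%classic : set R) by [].
have chi_d := @derivable_under_integral R _ _ (@lebesgue_measure R) (radial g w) _
  mT s (- r) r Is int_chi der _ (fun=> M0) intM bnd.
have chi_E := @differentiation_under_integral R _ _ (@lebesgue_measure R) (radial g w) _
  mT s (- r) r Is int_chi der _ (fun=> M0) intM bnd.
apply: DeriveDef => //; rewrite -derive1E chi_E.
by apply: eq_Rintegral => t _; exact: d1E.
Qed.

(** From chi = s N and chi' = N the quotient chi / s has derivative 0, so [N] is constant on
    positive radii. By continuity of g', its value is the limit 2 pi Re g'(w) at radius 0. *)
Lemma circle_mean s : 0 < s < r -> chi s = pi *+ 2 * (s * Re (dg w)).
Proof.
move=> /andP[s0 sr]; have r0 := lt_trans s0 sr.
have pos_lt x : 0 < x -> x < r -> `|x| < r by move=> x0; rewrite gtr0_norm.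
pose k x := x^-1 * chi x.
have kE x : 0 < x -> x < r -> k x = N x.
  by move=> x0 xr; rewrite /k chiE ?pos_lt // mulKf ?gt_eqF.
have kd x : 0 < x -> x < r -> is_derive x (1 : R) k 0.
  move=> x0 xr; have xn0 : x != 0 by rewrite gt_eqF.
  have dV : is_derive x (1 : R) (fun y : R => y^-1) (- x ^- 2).
    have := @is_deriveV R id x 1 1 xn0 (is_derive_id _ _).
    by rewrite /GRing.scale /= mulr1.
  have := is_derive_prod dV (is_derive_chi (pos_lt _ x0 xr)).
  by congr is_derive; rewrite chiE ?pos_lt //; field.
have kcst x : 0 < x -> x < r -> k x = k s.
  have H (a b : R) : 0 < a -> a <= b -> b < r -> k a = k b.
    move=> a0 ab br.
    have kab c : a <= c <= b -> is_derive c (1 : R) k 0.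
      by move=> /andP[ac cb]; apply: kd; [exact: lt_le_trans ac|exact: le_lt_trans br].
    have [|c _] := @MVT_segment _ k (cst 0) a b ab
        (fun c cab => kab c (subset_itv_oo_cc cab)).
      by apply: derivable_within_continuous => c /= cab; have [] := kab c cab.
    by rewrite mul0r => /eqP; rewrite subr_eq0 => /eqP.
  move=> x0 xr; have [xs|sx] := leP x s; first exact: H.
  by rewrite (H s x) // ltW.
suff : `|k s - pi *+ 2 * Re (dg w)| <= 0.
  rewrite normr_le0 subr_eq0 => /eqP; rewrite kE // => E.
  by rewrite chiE ?pos_lt // E mulrCA.
rewrite leNgt; apply/negP => d0.
have wr : cdisc w r w by rewrite /cdisc /= subrr cnorm0.
(* With this tolerance, 2 pi [e] is half of the supposed gap, so a circle small enough for g' to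
   vary by less than [e] contradicts the gap. *)
pose e := `|k s - pi *+ 2 * Re (dg w)| / (pi *+ 2) / 2.
have T0 : (0 : R) < pi *+ 2 by rewrite pmulrn_rgt0 // pi_gt0.
have e0 : 0 < e by rewrite !divr_gt0.
have /cvgCP/(_ _ e0) /nbhsCP[d dd dP] := dg_cont wr.
pose x := Num.min d s / 2.
have m0 : 0 < Num.min d s by rewrite lt_min dd.
have x0 : 0 < x by rewrite divr_gt0.
have xm : x < Num.min d s by rewrite ltr_pdivrMr // ltr_pMr // ltr1n.
have [xd xs] : x < d /\ x < s by move: xm; rewrite lt_min => /andP.
have xr := lt_trans xs sr.
suff : `|N x - pi *+ 2 * Re (dg w)| <= pi *+ 2 * e.
  rewrite -(kE _ x0 xr) (kcst _ x0 xr) /e.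
  move: d0; set D := `|_| => d0; set T := pi *+ 2 in T0 *.
  have -> : T * (D / T / 2) = D / 2.
    by rewrite mulrA [T * _]mulrC divfK ?gt_eqF.
  by move=> le_D; lra.
have cR : continuous (fun t => Re (dg (circle_pt w x t))).
  by apply: continuous_Re_circle => t; exact/dg_cont/circle_in/pos_lt.
rewrite -period_int_cst -period_intB //; last by move=> t; exact: cvg_cst.
apply: period_int_le => t /=.
  by apply: cvgB; [exact: cR|exact: cvg_cst].
rewrite -raddfB /=; apply: le_trans (Re_le_cnorm _) _; apply/ltW/dP.
by rewrite cnorm_circle gtr0_norm.
Qed.

End MeanFormula.
End CircleMean.

(** * Differentiability of the derivative *)

Section SecondDerivative.
Variable R : realType.
Local Notation C := (R[i]^o).
Local Notation Re := complex.Re.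
Local Notation Im := complex.Im.
Implicit Types (z w h : C) (g dg a : C -> C) (r t K M : R).

Lemma continuousCM (a b : C -> C) z : {for z, continuous a} ->
  {for z, continuous b} -> {for z, continuous (fun x => a x * b x)}.
Proof. by move=> ca cb; exact: (@cvgM R[i] C (nbhs z) _ a b (a z) (b z) ca cb). Qed.

Definition hol_disc g dg w M r :=
  [/\ forall z, cdisc w r z -> is_derive z (1 : C) g (dg z),
      forall z, cdisc w r z -> {for z, continuous dg} &
      forall z, cdisc w r z -> cnorm (dg z) <= M].

Lemma cdiscD w v r s z : cdisc w r v -> cdisc v s z -> cdisc w (r + s) z.
Proof.
rewrite /cdisc /= => wv vz; have -> : z - w = (v - w) + (z - v) by ring.
by apply: le_lt_trans (cnormD _ _) _; exact: ltrD.
Qed.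

Lemma hol_discS g dg w v M r s : hol_disc g dg w M (r + s) -> cdisc w r v ->
  hol_disc g dg v M s.
Proof.
by move=> [gd gc gM] wv; split=> z vz; [apply: gd|apply: gc|apply: gM]; exact: cdiscD vz.
Qed.

Lemma hol_discZ (c : C) g dg w M r : hol_disc g dg w M r ->
  hol_disc (fun z => c * g z) (fun z => c * dg z) w (cnorm c * M) r.
Proof.
move=> [gd gc gM]; split=> z wz.
- exact/is_deriveZ/gd.
- by apply: continuousCM; [exact: cst_continuous|exact: gc].
- by rewrite cnormM ler_wpM2l ?cnorm_ge0 //; exact: gM.
Qed.

Lemma radial_le (k : C -> C) w r t :
  `|radial k w r t| <= 2 * cnorm (k (circle_pt w r t)).
Proof.
rewrite /radial; apply: le_trans (ler_normD _ _) _; rewrite !normrM mulr2n mulrDl mul1r.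
by apply: lerD; rewrite -[leRHS]mulr1 ler_pM ?normr_ge0 ?cos_max ?sin_max
  ?Re_le_cnorm ?Im_le_cnorm.
Qed.

Lemma circle_ptD w h r t : circle_pt (w + h) r t = circle_pt w r t + h.
Proof.
by case: w h => p q [u v]; rewrite /circle_pt /=; simpc; congr Complex; ring.
Qed.

Lemma circle_in_disc w0 w r t : cdisc w0 r w -> 0 < r ->
  cdisc w0 (2 * r) (circle_pt w r t).
Proof.
rewrite /cdisc /= => ww r0.
have -> : circle_pt w r t - w0 = (w - w0) + (circle_pt w r t - w) by ring.
apply: le_lt_trans (cnormD _ _) _; rewrite cnorm_circle gtr0_norm // mulrDl mul1r.
exact: ltr_leD.
Qed.

(** [circle_mean] is applied at [w] and at [w + h]; the two circles are translates, so the integrals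
    subtract pointwise. Centres lie in the disc of radius [r], circles in that of radius [2 * r],
    and [circle_mean], used on discs of radius [2 * r] about the centres, asks for [3 * r]. *)
Lemma difference_Re g dg a w0 r M K w h : 0 < r ->
  hol_disc g dg w0 M (3 * r) ->
  (forall z, cdisc w0 (2 * r) z -> {for z, continuous a}) ->
  cdisc w0 r w -> cdisc w0 r (w + h) ->
  (forall z, cdisc w0 (2 * r) z -> cdisc w0 (2 * r) (z + h) ->
     cnorm (g (z + h) - g z - a z * h) <= K) ->
  `|pi *+ 2 * (r * Re (dg (w + h) - dg w)) - period_int (radial (fun z => a z * h) w r)|
    <= pi *+ 2 * (2 * K).
Proof.
move=> r0 hg ac ww wh gK; have [gd _ _] := hg.
have mean v : cdisc w0 r v -> period_int (radial g v r) = pi *+ 2 * (r * Re (dg v)).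
  move=> wv; have [|gd' gc' gM'] := @hol_discS g dg w0 v M r (2 * r) _ wv.
    by have -> : r + 2 * r = 3 * r by ring.
  by apply: (circle_mean gd' gc' gM'); rewrite r0 ltr_pMl // ltr1n.
have cg v : cdisc w0 r v -> continuous (radial g v r).
  move=> wv; apply: continuous_radial => t; apply: (@is_derive_cvg R[i]).
  apply: gd; move: (circle_in_disc t wv r0); rewrite /cdisc /=; lra.
have ca : continuous (radial (fun z => a z * h) w r).
  apply: continuous_radial => t; apply: continuousCM; last exact: cst_continuous.
  exact/ac/circle_in_disc.
rewrite raddfB mulrBr mulrBr -!mean // -period_intB; [|exact: cg..].
rewrite -period_intB //; last by move=> t; apply: cvgB; exact: cg.
apply: period_int_le => t.
  by apply: cvgB; [apply: cvgB; exact: cg|exact: ca].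
have -> : radial g (w + h) r t - radial g w r t - radial (fun z => a z * h) w r t =
    radial (fun z => g (z + h) - g z - a z * h) w r t.
  by rewrite /radial circle_ptD !raddfB /=; ring.
apply: le_trans (radial_le _ _ _ _) _; rewrite ler_wpM2l //.
by apply: gK; rewrite -?circle_ptD; exact: circle_in_disc.
Qed.

(* The mean of [a(w + r e^(i t)) e^(- i t) / r], that is, [a'(w)] when [a] is
   holomorphic. *)
Definition circle_deriv a w r : C :=
  (period_int (radial a w r) / (pi *+ 2 * r))
  +i* (period_int (radial (fun z => - 'i * a z) w r) / (pi *+ 2 * r)).

(** The real part of [h] times a e^(- i t) is expanded; the imaginary part of a e^(- i t) is the
    radial function of [- 'i * a]. This makes the integral linear in [h], with the coefficients of
    [circle_deriv]. *)
Lemma period_int_radialM a w r h :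
  (forall t, {for circle_pt w r t, continuous a}) ->
  period_int (radial (fun z => a z * h) w r) =
  Re h * period_int (radial a w r) -
  Im h * period_int (radial (fun z => - 'i * a z) w r).
Proof.
move=> ac; have ca := continuous_radial ac.
have ca' : continuous (radial (fun z => - 'i * a z) w r).
  apply: continuous_radial => t.
  by apply: continuousCM; [exact: cst_continuous|exact: ac].
rewrite -!period_intZ // -period_intB; first last.
- by move=> t; apply: cvgM; [exact: cvg_cst|exact: ca'].
- by move=> t; apply: cvgM; [exact: cvg_cst|exact: ca].
congr period_int; apply/funext => t; rewrite /radial.
by case: (a _) (h) => p q [u v]; simpc => /=; ring.
Qed.

(** [difference_Re] for [g] bounds the real part and, for [- 'i * g], the imaginary part. Both
    bounds are divided by 2 pi r and joined by [cnorm_le_Re]. *)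
Lemma difference_circle g dg a w0 r M K w h : 0 < r ->
  hol_disc g dg w0 M (3 * r) ->
  (forall z, cdisc w0 (2 * r) z -> {for z, continuous a}) ->
  cdisc w0 r w -> cdisc w0 r (w + h) ->
  (forall z, cdisc w0 (2 * r) z -> cdisc w0 (2 * r) (z + h) ->
     cnorm (g (z + h) - g z - a z * h) <= K) ->
  cnorm (dg (w + h) - dg w - circle_deriv a w r * h) <= 2 * (2 * K / r).
Proof.
move=> r0 hg ac ww wh gK.
have T0 : (0 : R) < pi *+ 2 by rewrite pmulrn_rgt0 // pi_gt0.
have step (x y : R) : `|pi *+ 2 * (r * x) - y| <= pi *+ 2 * (2 * K) ->
    `|x - y / (pi *+ 2 * r)| <= 2 * K / r.
  move: (pi *+ 2) T0 => T T0 xyK.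
  have -> : x - y / (T * r) = (T * r)^-1 * (T * (r * x) - y).
    by field; apply/andP; split; exact: lt0r_neq0.
  rewrite normrM gtr0_norm ?invr_gt0 ?mulr_gt0 // ler_pdivrMl ?mulr_gt0 //.
  by rewrite [leRHS](_ : _ = T * (2 * K)) //; field; exact: lt0r_neq0.
have ca t := ac _ (circle_in_disc t ww r0).
have gK' z : cdisc w0 (2 * r) z -> cdisc w0 (2 * r) (z + h) ->
    cnorm (- 'i * g (z + h) - - 'i * g z - - 'i * a z * h) <= K.
  move=> z2 zh2; have := gK z z2 zh2; congr (_ <= _).
  by rewrite -mulrA -!mulrBr cnormM cnormN cnormI mul1r.
have ac' z : cdisc w0 (2 * r) z -> {for z, continuous (fun z => - 'i * a z)}.
  by move=> z2; apply: continuousCM; [exact: cst_continuous|exact: ac].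
have := difference_Re r0 hg ac ww wh gK.
have := difference_Re r0 (hol_discZ (- 'i) hg) ac' ww wh gK'.
have ca' t := ac' _ (circle_in_disc t ww r0).
rewrite (period_int_radialM h (fun t => ca t)) (period_int_radialM h ca').
move=> /step dI /step dR; apply: cnorm_le_Re.
  move: dR; congr (`|_| <= _).
  rewrite /circle_deriv; move: (dg (w + h) - dg w) => [p q]; case: (h) => u v.
  by simpc => /=; ring.
move: dI; congr (`|_| <= _).
rewrite -mulrBr /circle_deriv.
have -> : radial (fun z => - 'i * (- 'i * a z)) w r = fun t => -1 * radial a w r t.
  by apply/funext => t; rewrite /radial; case: (a _) => p q; simpc => /=; ring.
rewrite period_intZ; last exact: continuous_radial.
by move: (dg (w + h) - dg w) => [p q]; case: (h) => u v; simpc => /=; ring.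
Qed.

Lemma deriv_lipschitz g dg w0 M r w h : 0 < r ->
  hol_disc g dg w0 M (3 * r) -> cdisc w0 r w -> cdisc w0 r (w + h) ->
  cnorm (dg (w + h) - dg w) <= 8 * M / r * cnorm h.
Proof.
move=> r0 hg ww wh; have [gd gc gM] := hg.
have sub z : cdisc w0 (2 * r) z -> cdisc w0 (3 * r) z by rewrite /cdisc /=; lra.
have c0 : circle_deriv (cst 0) w r = 0.
  have rad0 (k : C -> C) : k = cst 0 -> period_int (radial k w r) = 0.
    move=> ->; rewrite -[RHS](mulr0 (pi *+ 2)) -period_int_cst; congr period_int.
    by apply/funext => t; rewrite /radial /= !mul0r addr0.
  rewrite /circle_deriv !rad0 ?mul0r //.
  by apply/funext => z /=; rewrite mulr0.
have dE : dg (w + h) - dg w = dg (w + h) - dg w - circle_deriv (cst 0) w r * h.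
  by rewrite c0 mul0r subr0.
rewrite {}dE.
(* With [a = 0], [mean_value] bounds the increments of [g] by [2 * (M * cnorm h)]; the constant 8 is
   this 2 times the 4 of [difference_circle]. *)
have K := @difference_circle g dg (cst 0) w0 r M (2 * (M * cnorm h)) w h r0 hg.
apply: le_trans (K _ ww wh _) _.
- by move=> z _; exact: cst_continuous.
- move=> z z2 zh2; apply: (@mean_value _ g dg) => s s01.
    exact/gd/sub/cdisc_segment.
  by rewrite [_ - _]subr0; exact/gM/sub/cdisc_segment.
by rewrite le_eqVlt; apply/orP; left; apply/eqP; field; exact: lt0r_neq0.
Qed.

Lemma deriv_quadratic g dg w0 M r w h : 0 < r -> 0 <= M ->
  hol_disc g dg w0 M (3 * r) -> cdisc w0 r w -> cdisc w0 r (w + h) ->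
  cnorm (g (w + h) - g w - dg w * h) <= 16 * M / r * cnorm h ^+ 2.
Proof.
move=> r0 M0 hg ww wh; have [gd gc gM] := hg.
have -> : 16 * M / r * cnorm h ^+ 2 = 2 * (8 * M / r * cnorm h * cnorm h).
  by rewrite expr2; field; exact: lt0r_neq0.
apply: (@mean_value _ g dg) => s s01.
  apply: gd; have := cdisc_segment s01 ww wh; rewrite /cdisc /=; lra.
have := deriv_lipschitz r0 hg ww (cdisc_segment s01 ww wh).
move=> /le_trans; apply; rewrite ler_wpM2l //.
  by rewrite divr_ge0 ?(ltW r0) // mulr_ge0.
have /andP[s0 s1] := s01; rewrite cnormM cnormC ger0_norm //.
by rewrite ler_piMl // cnorm_ge0.
Qed.

(** The choice [a = dg] in [difference_circle], with [circle_deriv dg] as second derivative. The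
    remainder of [g] is needed on the disc of radius [2 * r]; [deriv_quadratic] gives it on radius
    [3 * r], at the price of radius [9 * r]. *)
Lemma second_deriv_quadratic g dg w0 M r : 0 < r -> 0 <= M ->
  hol_disc g dg w0 M (9 * r) -> exists (H : C -> C) (Q : R), 0 <= Q /\
  forall w h, cdisc w0 r w -> cdisc w0 r (w + h) ->
    cnorm (dg (w + h) - dg w - H w * h) <= Q * cnorm h ^+ 2.
Proof.
move=> r0 M0 hg; have r3 : 0 < 3 * r by rewrite mulr_gt0.
have hg3 : hol_disc g dg w0 M (3 * (3 * r)) by rewrite mulrA -natrM.
have [gd gc gM] := hg.
have hg1 : hol_disc g dg w0 M (3 * r).
  by split=> z; rewrite /cdisc /= => zr; [apply: gd|apply: gc|apply: gM];
    rewrite /cdisc /=; lra.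
pose Q0 := 16 * M / (3 * r); exists (fun w => circle_deriv dg w r), (4 * Q0 / r); split.
  have r_ge0 := ltW r0.
  by rewrite /Q0 !mulr_ge0 ?invr_ge0 ?mulr_ge0.
move=> w h ww wh.
have -> : 4 * Q0 / r * cnorm h ^+ 2 = 2 * (2 * (Q0 * cnorm h ^+ 2) / r).
  by field; exact: lt0r_neq0.
apply: (difference_circle r0 hg1 _ ww wh) => z.
  by move=> z2; apply: gc; move: z2; rewrite /cdisc /=; lra.
move=> z2 zh2; apply: (deriv_quadratic r3 M0 hg3).
- by move: z2; rewrite /cdisc /=; lra.
- by move: zh2; rewrite /cdisc /=; lra.
Qed.

Lemma cdisc_nbhs w0 r w : cdisc w0 r w -> exists2 d : R, 0 < d &
  forall z, cnorm (z - w) < d -> cdisc w0 r z.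
Proof.
rewrite /cdisc /= => ww; exists (r - cnorm (w - w0)); first by rewrite subr_gt0.
move=> z zw; have -> : z - w0 = (z - w) + (w - w0) by ring.
by apply: le_lt_trans (cnormD _ _) _; rewrite -ltrBrDr.
Qed.

(** * Functions with quadratic Taylor remainders *)

Section Quadratic.
Variables (k H : C -> C) (w0 : C) (r Q : R).
Hypothesis Q_ge0 : 0 <= Q.
Hypothesis quadratic : forall w h, cdisc w0 r w -> cdisc w0 r (w + h) ->
  cnorm (k (w + h) - k w - H w * h) <= Q * cnorm h ^+ 2.

(** A Lipschitz bound at [w], kept multiplied by [z - w] because quadratic remainders come in that
    form. Dividing by [K + 1] rather than [K] allows [K = 0]. *)
Let cvg_linear (f : C -> C) w K : 0 <= K -> cdisc w0 r w ->
  (forall z, cdisc w0 r z -> z != w ->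
    cnorm ((f z - f w) * (z - w)) <= K * cnorm (z - w) ^+ 2) ->
  {for w, continuous f}.
Proof.
move=> K0 ww fK.
apply/(@cvgCP R C (nbhs w) f (f w) (nbhs_filter w)) => e e0; apply/nbhsCP.
have [d d0 dP] := cdisc_nbhs ww.
have K1 : 0 < K + 1 by rewrite ltr_wpDl.
exists (Num.min d (e / (K + 1))); first by rewrite lt_min d0 divr_gt0.
move=> z; rewrite lt_min => /andP[/dP zr].
rewrite ltr_pdivlMr // => ze; have [->|zw] := eqVneq z w; first by rewrite subrr cnorm0.
have n0 : 0 < cnorm (z - w).
  rewrite lt_neqAle cnorm_ge0 andbT; apply/eqP => /esym/cnorm0_eq0/eqP.
  by rewrite subr_eq0; exact/negP.
have := fK z zr zw; rewrite cnormM expr2 mulrA ler_pM2r // => /le_lt_trans; apply.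
by apply: le_lt_trans ze; rewrite mulrC ler_wpM2l ?cnorm_ge0 // lerDl.
Qed.

Lemma quadratic_is_derive w : cdisc w0 r w -> is_derive w (1 : C) k (H w).
Proof.
move=> ww; pose phi z := if z == w then H w else (k z - k w) / (z - w).
apply: (@slope_is_derive R[i] _ _ phi) => [|z]; last first.
  rewrite /phi; case: eqVneq => [->|zw]; first by rewrite !subrr scale0r.
  by rewrite /GRing.scale /= mulrC divfK // subr_eq0.
have <- : phi w = H w by rewrite /phi eqxx.
apply: (cvg_linear Q_ge0) => // z zr zw; rewrite /phi eqxx (negbTE zw).
rewrite mulrBl divfK ?subr_eq0 //.
have := quadratic ww (_ : cdisc w0 r (w + (z - w))).
by rewrite addrC subrK; apply.
Qed.

(** Adding the expansions from [w] to [z] and from [z] to [w] cancels the values of [k] and leaves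
    [(H z - H w) * (z - w)], bounded by twice the remainder. *)
Lemma quadratic_continuous w : cdisc w0 r w -> {for w, continuous H}.
Proof.
move=> ww; have Q2 : 0 <= 2 * Q by rewrite mulr_ge0.
apply: (cvg_linear Q2) => // z zr zw.
have := quadratic ww (_ : cdisc w0 r (w + (z - w))).
rewrite addrC subrK => /(_ zr) E1.
have := quadratic zr (_ : cdisc w0 r (z + (w - z))).
rewrite [z + _]addrC subrK => /(_ ww) E2.
have -> : (H z - H w) * (z - w) =
    (k z - k w - H w * (z - w)) + (k w - k z - H z * (w - z)) by ring.
apply: le_trans (cnormD _ _) _.
by rewrite -mulrA mulr2n mulrDl mul1r lerD // [cnorm (z - w)]cnorm_distC.
Qed.
End Quadratic.

Lemma derivable_derive (D : set C) g dg : open D ->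
  (forall z, D z -> is_derive z (1 : C) g (dg z)) ->
  (forall z, D z -> {for z, continuous dg}) ->
  forall z, D z -> derivable dg z (1 : C) /\
    {for z, continuous (fun w => 'D_(1 : C) dg w)}.
Proof.
move=> Do gd gc z Dz.
have /nbhsCP[d d0 dD] : nbhs z D by move: Do; rewrite openE; apply.
have /cvgCP/(_ 1 ltr01) /nbhsCP[e e0 eM] := gc z Dz.
(* The disc of radius [9 * r] lies in [D], and on it [dg] stays within 1 of [dg z]; hence the bound
   [cnorm (dg z) + 1]. *)
pose r := Num.min d e / 9; have m0 : 0 < Num.min d e by rewrite lt_min d0.
have r0 : 0 < r by rewrite divr_gt0.
have hg : hol_disc g dg z (cnorm (dg z) + 1) (9 * r).
  have -> : 9 * r = Num.min d e by rewrite /r mulrC divfK.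
  split=> w; rewrite /cdisc /= lt_min => /andP[wd we].
  - exact/gd/dD.
  - exact/gc/dD.
  - have -> : dg w = dg z + (dg w - dg z) by ring.
    by apply: le_trans (cnormD _ _) _; rewrite lerD2l; exact/ltW/eM.
have M0 : 0 <= cnorm (dg z) + 1 by rewrite addr_ge0 ?cnorm_ge0.
have [H [Q [Q0 quad]]] := second_deriv_quadratic r0 M0 hg.
have dH w : cdisc z r w -> is_derive w (1 : C) dg (H w).
  exact: (@quadratic_is_derive dg H z r Q Q0 quad).
have zr : cdisc z r z by rewrite /cdisc /= subrr cnorm0.
split; first by have [] := dH z zr.
apply: (@quadratic_continuous dg (fun w => 'D_(1 : C) dg w) z r Q Q0 _ z zr).
move=> w h wr whr.
by have [_ ->] := dH w wr; exact: quad.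
Qed.

End SecondDerivative.

(** * Derivatives of complex Nash functions *)

Lemma is_derive_horner (K : numFieldType) (p : {poly K}) (z : K^o) :
  is_derive z (1 : K^o) (fun w : K^o => p.[w] : K^o) p^`().[z].
Proof.
elim/poly_ind: p => [|p c IH].
  have -> : (fun w : K^o => (0 : {poly K}).[w] : K^o) = cst 0.
    by apply/funext => w; rewrite horner0.
  by rewrite deriv0 horner0; exact: is_derive_cst.
have -> : (fun w : K^o => (p * 'X + c%:P).[w] : K^o) =
    (fun w : K^o => p.[w] : K^o) * id + cst c.
  by apply/funext => w; rewrite !fctE !hornerE.
have := is_deriveD (is_deriveM IH (is_derive_id z (1 : K^o)))
  (is_derive_cst (c : K^o) z (1 : K^o)).
congr is_derive; rewrite derivMXaddC /GRing.scale /= !hornerE; ring.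
Qed.

Lemma is_derive_bivariate (K : numFieldType) (Q : {poly {poly K}}) (g : K^o -> K^o)
    (z d : K^o) : is_derive z (1 : K^o) g d ->
  is_derive z (1 : K^o) (fun w => Q.[g w, w])
    ((map_poly deriv Q).[g z, z] + d * Q^`().[g z, z]).
Proof.
move=> gd; elim/poly_ind: Q => [|p c IH].
  rewrite raddf0 deriv0 !horner0 mulr0 addr0.
  have -> : (fun w => (0 : {poly {poly K}}).[g w, w]) = cst 0.
    by apply/funext => w; rewrite !horner0.
  exact: is_derive_cst.
have -> : (fun w => (p * 'X + c%:P).[g w, w]) =
    (fun w => p.[g w, w] : K^o) * g + (fun w => (c : {poly K}).[w] : K^o).
  by apply/funext => w; rewrite !fctE !hornerE.
have := is_deriveD (is_deriveM IH gd) (@is_derive_horner K c z).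
have -> : map_poly deriv (p * 'X + c%:P) = map_poly deriv p * 'X + (c^`())%:P.
  rewrite raddfD /= map_polyC; congr (_ + _); apply/polyP => i.
  by rewrite coef_map !coefMX; case: (i == 0)%N; rewrite ?raddf0 // coef_map.
congr is_derive; rewrite derivMXaddC /GRing.scale /= !hornerE; ring.
Qed.

Section Nash.
Variable R : realType.
Local Notation C := (R[i]^o).

Lemma annihilant_derive (U : set C) (g : C -> C) (P : {poly {poly R[i]}}) :
  open U -> (forall w, U w -> derivable g w (1 : C)) -> P != 0 ->
  (forall w, U w -> P.[w, g w] = 0) ->
  exists2 P' : {poly {poly R[i]}}, P' != 0 & forall w, U w -> P'.[w, 'D_1 g w] = 0.
Proof.
move=> Uo gd P0 PU; pose G w a := U w /\ a = g w.
(* After the swap the outer variable stands for the value g(w), so gcds and degrees are taken in t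
   over the polynomials in z. *)
have [||Q [Q0 QG cQ]] := @coprime_annihilant _ G (swapXY P).
- by rewrite swapXY_eq0.
- by move=> w a [Uw ->]; rewrite horner2_swapXY PU.
have [T T0 TQ] := slope_annihilant Q0 cQ.
exists (swapXY T) => [|w Uw]; first by rewrite swapXY_eq0.
rewrite horner2_swapXY; apply: (TQ _ (g w)); first exact: QG.
(* The slope relation is the derivative of [Q.[g w, w]], which is zero because this function
   vanishes on the open set [U]. *)
have [_ <-] := is_derive_bivariate Q (derivableP (gd w Uw)).
rewrite (@near_eq_derive _ _ _ _ (cst 0)) ?derive_cst //.
by apply: filterS (open_nbhs_nbhs (conj Uo Uw)) => v Uv; exact: QG.
Qed.

Lemma complex_nash_derive (D : set C) (g : C -> C) : open D ->
  (forall z, D z -> {for z, continuous (fun w => 'D_(1 : C) g w)}) ->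
  complex_nash D g -> complex_nash D (fun w => 'D_(1 : C) g w).
Proof.
move=> Do gc gN.
have gd z : D z -> is_derive z (1 : C) g ('D_(1 : C) g z).
  by move=> /gN[U [_ Uz _ + _]] => /(_ z Uz) /derivableP.
move=> z Dz; have [U [Uo Uz UD Ud [P P0 PU]]] := gN z Dz.
exists U; split; [exact: Uo|exact: Uz|exact: UD| |].
  move=> w /UD Dw; exact: (derivable_derive Do gd gc Dw).1.
exact: annihilant_derive Uo Ud P0 PU.
Qed.
End Nash.

(** * Holomorphic coordinates of stem functions *)

(** Induction over the doublings: a linear form on pairs is the sum of its restrictions to the two
    halves. *)
Lemma cd_linear_continuous (R : realType) n (l : cd R n -> R) :
  {morph l : x y / x + y} -> (forall k x, l (k *: x) = k * l x) -> continuous l.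
Proof.
elim: n l => [|n IH] l lD lZ.
  have -> : l = (fun x : R => x * l (1 : R)).
    by apply/funext => x; rewrite -lZ /GRing.scale /= mulr1.
  by move=> x; apply: cvgM; [exact: cvg_id|exact: cvg_cst].
have -> : l = (fun x => l (x.1, 0) + l (0, x.2)).
  apply/funext => -[x y] /=; rewrite -lD; congr l.
  by congr pair; rewrite /= ?addr0 ?add0r.
have c1 : continuous (fun x : cd R n => l (x, 0)).
  apply: IH => [x y|k x]; [rewrite -lD|rewrite -lZ]; congr l; congr pair => /=.
    by rewrite addr0.
  by rewrite scaler0.
have c2 : continuous (fun x : cd R n => l (0, x)).
  apply: IH => [x y|k x]; [rewrite -lD|rewrite -lZ]; congr l; congr pair => /=.
    by rewrite addr0.
  by rewrite scaler0.
move=> [x y]; apply: cvgD => /=.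
- by apply: (@cvg_comp _ _ _ fst (fun x => l (x, 0))); [exact: cvg_fst|exact: c1].
- by apply: (@cvg_comp _ _ _ snd (fun x => l (0, x))); [exact: cvg_snd|exact: c2].
Qed.

Section Coordinates.
Variables (R : realType) (A : hypercomplex).
Local Notation C := (R[i]^o).
Local Notation AA := (carrier R A).
Local Notation Re := complex.Re.
Local Notation Im := complex.Im.
Implicit Types (I x y e : AA) (z w c : C) (D : set C) (F : C -> AA * AA).

(* The element [c e] of the complexification of A. *)
Definition tens c e : AA * AA := (Re c *: e, Im c *: e).

Lemma iota_mulD p q : @iota_mul R A (p + q) = iota_mul p + iota_mul q.
Proof. by rewrite /iota_mul /=; congr pair => /=; rewrite opprD. Qed.

Lemma iota_mul_tens c e : iota_mul (tens c e) = tens ('i * c) e.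
Proof. by case: c => a b; rewrite /iota_mul /tens; simpc => /=; rewrite scaleNr. Qed.

Lemma cvg_tens (T : Type) (f : set_system T) (h : T -> C) c e : Filter f ->
  h @ f --> c -> (fun t => tens (h t) e) @ f --> tens c e.
Proof.
move=> ff hc; apply: cvg_pair => /=; apply: cvgZr_tmp.
- exact: cvg_Re.
- exact: cvg_Im.
Qed.

Lemma is_derive_tens (g : C -> C) w d (x y : R -> R) (t x' y' : R) e :
  is_derive w (1 : C) g d -> is_derive t (1 : R) x x' -> is_derive t (1 : R) y y' ->
  x t +i* y t = w ->
  is_derive (t : R^o) (1 : R^o) (fun s : R^o => tens (g (x s +i* y s)) e)
    (tens (d * (x' +i* y')) e).
Proof.
move=> gd dx dy gt.
have [u [_ ud uE]] := is_derive_slope (is_derive_Re_curve gd dx dy gt).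
have [v [_ vd vE]] := is_derive_slope (is_derive_Im_curve gd dx dy gt).
apply: (@slope_is_derive _ _ _ (fun s => tens (u s +i* v s) e)).
  apply: cvg_tens; have := cvg_complex (nbhs_filter (t : R^o)) ud vd.
  by case: (d * _).
move=> s; rewrite /tens; congr pair => /=.
  by rewrite -scalerBl uE scalerA.
by rewrite -scalerBl vE scalerA.
Qed.

Lemma is_derive_bigsum (T : finType) (h : T -> R^o -> AA * AA) (a : R^o)
    (dh : T -> AA * AA) : (forall t, is_derive a (1 : R^o) (h t) (dh t)) ->
  is_derive a (1 : R^o) (fun s => \sum_t h t s) (\sum_t dh t).
Proof.
move=> hd; have -> : (fun s => \sum_t h t s) = \sum_t h t.
  by apply/funext => s; rewrite fct_sumE.
elim/big_ind2 : _ => [|u du v dv hu hv|t _]; last exact: hd.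
- exact: is_derive_cst.
- exact: is_deriveD.
Qed.

Section HolomorphicCoordinates.
Variables (T : finType) (e : T -> AA) (g dg : T -> C -> C).
Variables (D : set C) (F : C -> AA * AA).
Hypothesis D_open : open D.
Hypothesis FE : forall z, D z -> F z = \sum_t tens (g t z) (e t).
Hypothesis g_hol : forall t z, D z -> is_derive z (1 : C) (g t) (dg t z).

Let near_D (z : C) (f : R^o -> C) (s : R^o) : f @ s --> f s -> D (f s) ->
  \forall u \near s, D (f u).
Proof.
by move=> fs Ds; apply: fs; apply: open_nbhs_nbhs; split.
Qed.

Lemma is_derive_line_re z : D z -> is_derive (Re z : R^o) (1 : R^o) (line_re F z)
  (\sum_t tens (dg t z) (e t)).
Proof.
move=> Dz; have zE : Re z +i* Im z = z by case: (z).
pose f (s : R^o) : C := s +i* Im z.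
have fc : f @ (Re z : R^o) --> f (Re z).
  by apply: cvg_complex; [exact: cvg_id|exact: cvg_cst].
apply: (@near_eq_is_derive _ _ _ (fun s => \sum_t tens (g t (f s)) (e t))).
  have := near_D z fc; rewrite /f zE => /(_ Dz).
  by apply: filterS => s Ds; rewrite /line_re FE.
apply: is_derive_bigsum => t.
have -> : dg t z = dg t z * (1 +i* 0) by rewrite mulr1.
exact: (is_derive_tens _ (g_hol t Dz) (is_derive_id _ _) (is_derive_cst _ _ _) zE).
Qed.

Lemma is_derive_line_im z : D z -> is_derive (Im z : R^o) (1 : R^o) (line_im F z)
  (\sum_t tens ('i * dg t z) (e t)).
Proof.
move=> Dz; have zE : Re z +i* Im z = z by case: (z).
pose f (s : R^o) : C := Re z +i* s.
have fc : f @ (Im z : R^o) --> f (Im z).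
  by apply: cvg_complex; [exact: cvg_cst|exact: cvg_id].
apply: (@near_eq_is_derive _ _ _ (fun s => \sum_t tens (g t (f s)) (e t))).
  have := near_D z fc; rewrite /f zE => /(_ Dz).
  by apply: filterS => s Ds; rewrite /line_im FE.
apply: is_derive_bigsum => t; rewrite mulrC.
exact: (is_derive_tens _ (g_hol t Dz) (is_derive_cst _ _ _) (is_derive_id _ _) zE).
Qed.

Lemma d_alphaE z : D z -> d_alpha F z = \sum_t tens (dg t z) (e t).
Proof. by move=> /is_derive_line_re[]. Qed.

Lemma d_betaE z : D z -> d_beta F z = \sum_t tens ('i * dg t z) (e t).
Proof. by move=> /is_derive_line_im[]. Qed.

(** The Cauchy-Riemann equation, inherited from the coordinates: a vertical line has direction ['i],
    which multiplies each [dg t]. *)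
Lemma d_beta_iota z : D z -> d_beta F z = iota_mul (d_alpha F z).
Proof.
move=> Dz; rewrite d_betaE // d_alphaE //.
rewrite (big_morph (@iota_mul R A) iota_mulD (id1 := 0)); last first.
  by rewrite /iota_mul /= oppr0.
by apply: eq_bigr => t _; rewrite iota_mul_tens.
Qed.

(** By the Cauchy-Riemann equation, - iota dF/dbeta equals dF/dalpha, so the half sum is dF/dalpha
    alone. *)
Lemma d_zE z : D z -> d_z F z = \sum_t tens (dg t z) (e t).
Proof.
move=> Dz; rewrite -d_alphaE // /d_z d_beta_iota //.
have -> : iota_mul (iota_mul (d_alpha F z)) = - d_alpha F z by [].
by rewrite opprK -[X in _ *: (X + X)]scale1r -scalerDl scalerA mulVf ?scale1r.
Qed.

Lemma cvg_tens_sum (h : T -> C -> C) z : (forall t, {for z, continuous (h t)}) ->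
  (fun w => \sum_t tens (h t w) (e t)) @ z --> \sum_t tens (h t z) (e t).
Proof.
move=> hc; have -> : (fun w => \sum_t tens (h t w) (e t)) =
    \sum_t (fun w => tens (h t w) (e t)).
  by apply/funext => w; rewrite fct_sumE.
elim/big_ind2 : _ => [|u u' v v' hu hv|t _].
- exact: (@cvg_cst (AA * AA)%type 0 C (nbhs z) _).
- exact: (cvgD hu hv).
- exact: (cvg_tens (nbhs_filter z) (hc t)).
Qed.

Let near_cvg (W : topologicalType) (h k : C -> W) z : D z ->
  (forall w, D w -> h w = k w) -> k @ z --> k z -> h @ z --> h z.
Proof.
move=> Dz hk kz; rewrite hk //; apply: cvg_trans kz.
apply: (near_eq_cvg (FF := nbhs_filter z)).
apply: (@filterS _ _ (nbhs_filter z) D) => [w Dw|]; first by rewrite hk.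
by apply: open_nbhs_nbhs; split.
Qed.

Lemma holomorphic_coordinates :
  (forall t z, D z -> {for z, continuous (dg t)}) -> stem_holomorphic D F.
Proof.
move=> dgc; split=> [z Dz|z Dz]; last first.
  by rewrite d_beta_iota //; exact: subrr.
split.
- by have [] := is_derive_line_re Dz.
- by have [] := is_derive_line_im Dz.
- apply: (near_cvg Dz d_alphaE); apply: cvg_tens_sum => t; exact: dgc.
- apply: (near_cvg Dz d_betaE); apply: cvg_tens_sum => t.
  by apply: continuousCM; [exact: cst_continuous|exact: dgc].
Qed.

(** A complex Nash function is only required to be differentiable, while the circle means need a
    continuous derivative. The forms [l], dual to [e], extract it from the continuous
    [d_alpha F]. *)
Lemma coordinate_continuous (l : T -> AA -> R) :
  (forall t, continuous (l t)) ->
  (forall (x : T -> R) t, l t (\sum_t x t *: e t) = x t) ->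
  of_class_C1 D F -> forall t z, D z -> {for z, continuous (dg t)}.
Proof.
move=> lc lE FC t z Dz; have [_ _ ac _] := FC z Dz.
have sumE w : \sum_t tens (dg t w) (e t) =
    (\sum_t Re (dg t w) *: e t, \sum_t Im (dg t w) *: e t).
  by elim/big_rec3 : _ => // {}t x y p _ ->.
have dgE w : D w -> dg t w = l t (d_alpha F w).1 +i* l t (d_alpha F w).2.
  by move=> Dw; rewrite d_alphaE // sumE /= !lE; case: (dg t w).
have a1 : (fun w => (d_alpha F w).1) @ z --> (d_alpha F z).1.
  have fc : fst @ d_alpha F z --> (d_alpha F z).1 by exact: cvg_fst.
  exact: (cvg_comp _ _ ac fc).
have a2 : (fun w => (d_alpha F w).2) @ z --> (d_alpha F z).2.
  have fc : snd @ d_alpha F z --> (d_alpha F z).2 by exact: cvg_snd.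
  exact: (cvg_comp _ _ ac fc).
apply: (near_cvg Dz dgE); apply: (cvg_complex (nbhs_filter z)).
- exact: (cvg_comp _ _ a1 (lc t _)).
- exact: (cvg_comp _ _ a2 (lc t _)).
Qed.

End HolomorphicCoordinates.

Lemma slice_point_mul I c x : slice_point I c ** x = Re c *: x + Im c *: (I ** x).
Proof. by rewrite /slice_point cd_mulD !cd_mulZ cd_mul1. Qed.

(** * Real coordinates in a splitting base *)

Section SplittingBase.
Variables (I : AA) (J : 'I_(u_ A).+1 -> AA).
Hypothesis IJ : splitting_base I J.

Definition real_base (t : 'I_(u_ A).+1 + 'I_(u_ A).+1) : AA :=
  match t with inl k => J k | inr k => I ** J k end.

(** Generation and freeness provide unique C_I-coordinates; uniqueness makes them real-linear, hence
    continuous. Their real and imaginary parts are the forms dual to [real_base]. *)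
Lemma real_coordinates : exists l : 'I_(u_ A).+1 + 'I_(u_ A).+1 -> AA -> R,
  (forall t, continuous (l t)) /\
  (forall (x : _ -> R) t, l t (\sum_t x t *: real_base t) = x t).
Proof.
have [_ _ free gen] := IJ.
pose S (c : 'I_(u_ A).+1 -> C) := \sum_k slice_point I (c k) ** J k.
have SD a b (r : R) : S (fun k => a k + r%:C * b k) = S a + r *: S b.
  rewrite /S scaler_sumr -big_split; apply: eq_bigr => k _ /=.
  rewrite !slice_point_mul; case: (a k) (b k) => p q [u v]; simpc => /=.
  by rewrite !scalerDl !scalerDr !scalerA !addrA; congr (_ + _); rewrite addrAC.
have SI a b : S a = S b -> a = b.
  move=> ab; have := free (fun k => a k + (-1)%:C * b k); rewrite -/(S _) SD ab.
  rewrite scaleN1r subrr => /(_ erefl) H; apply/funext => k.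
  have := H k; rewrite rmorphN1 mulN1r => /eqP.
  by rewrite subr_eq0 => /eqP.
have [c cE] := choice gen.
(* A single identity for additivity ([r = 1]) and homogeneity ([x = 0]). *)
have cD x y (r : R) : c (x + r *: y) = fun k => c x k + r%:C * c y k.
  by apply: SI; rewrite SD -!/(S _) /S -!cE.
have lin (f : C -> R) : {morph f : a b / a + b} ->
    (forall (r : R) a, f (r%:C * a) = r * f a) ->
    forall k, continuous (fun x => f (c x k)).
  move=> fD fZ k; have c0 : c 0 k = 0.
    have := cD 0 0 (-1); rewrite scaler0 addr0 => /(congr1 (fun h => h k)) /= E.
    by rewrite E rmorphN1 mulN1r subrr.
  apply: cd_linear_continuous => [x y|r x].
    by have := cD x y 1; rewrite scale1r => ->; rewrite mul1r fD.
  by have := cD 0 x r; rewrite add0r => ->; rewrite c0 add0r fZ.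
exists (fun t x => match t with inl k => Re (c x k) | inr k => Im (c x k) end); split.
  move=> [k|k]; apply: lin; try exact: raddfD.
  - by move=> r [p q]; simpc.
  - by move=> r [p q]; simpc.
move=> x; have E : c (\sum_t x t *: real_base t) = fun k => x (inl k) +i* x (inr k).
  apply: SI; rewrite /S -cE big_sumType /= -big_split; apply: eq_bigr => k _.
  by rewrite slice_point_mul.
by move=> [k|k]; rewrite E.
Qed.
End SplittingBase.
End Coordinates.

(** * Slice derivatives of slice-Nash functions *)

Section SliceDerivative.
Variables (R : realType) (A : hypercomplex).
Local Notation C := (R[i]^o).
Local Notation AA := (carrier R A).
Local Notation Re := complex.Re.
Local Notation Im := complex.Im.
Implicit Types (z : C) (D : set C) (F : C -> AA * AA) (f : AA -> AA).

(** Conjugation fixes [Re z], so near it the horizontal line through [z^*] carries the conjugate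
    values of [F]. This yields the stem symmetry of the derivative. *)
Lemma is_derive_line_re_conj D F z d : stem_function D F -> D z ->
  is_derive (Re z : R^o) (1 : R^o) (line_re F z) d ->
  is_derive (Re z : R^o) (1 : R^o) (line_re F z^*) (d.1, - d.2).
Proof.
move=> [Do _ Fc] Dz Fd; have [phi [_ phid FE]] := is_derive_slope Fd.
have zE : Re z +i* Im z = z by case: (z).
pose k (s : R^o) : AA * AA := ((line_re F z s).1, - (line_re F z s).2).
apply: (@near_eq_is_derive _ _ _ k).
  have fc : (fun s : R^o => s +i* Im z : C) @ (Re z : R^o) --> (Re z +i* Im z : C).
    by apply: cvg_complex; [exact: cvg_id|exact: cvg_cst].
  have : nbhs (Re z +i* Im z : C) D by rewrite zE; apply: open_nbhs_nbhs; split.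
  move=> /fc; apply: (filterS (F := nbhs (Re z : R^o))) => s Ds.
  by rewrite /k /line_re -Fc //; case: (z).
apply: (@slope_is_derive _ _ _ (fun s => ((phi s).1, - (phi s).2))).
  have fc : fst @ d --> d.1 by case: (d) => u v; exact: cvg_fst.
  have sc : snd @ d --> d.2 by case: (d) => u v; exact: cvg_snd.
  apply: cvg_pair => /=; first exact: (cvg_comp _ _ phid fc).
  by apply: cvgN; exact: (cvg_comp _ _ phid sc).
move=> s; have := FE s; rewrite /k; case: (line_re F z s) => a b.
case: (line_re F z (Re z)) => a' b' [E1 E2]; congr pair => /=.
  exact: E1.
by rewrite scalerN -E2 opprB opprK addrC.
Qed.

(** The choice made in [stem_of] succeeds because [F] is a candidate; uniqueness of stem functions
    then identifies the two on the profile. *)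
Lemma stem_functionP (Omega : set AA) F f :
  stem_function (profile Omega) F -> induces (profile Omega) F f ->
  [/\ stem_function (profile Omega) (stem_of Omega f),
      induces (profile Omega) (stem_of Omega f) f &
      forall z, profile Omega z -> stem_of Omega f z = F z].
Proof.
move=> sF iF; rewrite /stem_of; case: xgetP => [G _ [sG iG]|/(_ F)]; last by case.
by split=> // z; exact: stem_function_unique sG sF iG iF z.
Qed.

Lemma slice_nash_derivative (Omega : set AA) f :
  slice_nash Omega f -> slice_nash Omega (slice_derivative Omega f).
Proof.
move=> [F [sF iF [FC1 _] [I [J [IJ [c1 [c2 [Fc gN]]]]]]]].
have [sG iG GF] := stem_functionP sF iF.
set D := profile Omega in sF iF FC1 Fc gN sG iG GF *.
set G := stem_of Omega f in sG iG GF *.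
have [Do Dc _] := sF.
(* Left indices stand for the base elements [J k], right ones for [I ** J k]; [g] lists the
   coordinates that [stem_nash] declares complex Nash. *)
pose T := ('I_(u_ A).+1 + 'I_(u_ A).+1)%type; pose e : T -> AA := real_base I J.
pose g (t : T) : C -> C := match t with
  | inl k => fun z => Re (c1 k z) +i* Re (c2 k z)
  | inr k => fun z => Im (c1 k z) +i* Im (c2 k z) end.
pose dg (t : T) : C -> C := fun z => 'D_(1 : C) (g t) z.
pose ddg (t : T) : C -> C := fun z => 'D_(1 : C) (dg t) z.
have g_nash t : complex_nash D (g t).
  by case: t => k; [exact: (gN k).1|exact: (gN k).2].
have sumE (h : T -> C) : \sum_t tens (h t) (e t) =
    (\sum_k slice_point I (Re (h (inl k)) +i* Re (h (inr k))) ** J k,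
     \sum_k slice_point I (Im (h (inl k)) +i* Im (h (inr k))) ** J k).
  rewrite big_sumType /= -big_split /=.
  elim/big_rec3 : _ => // k x y p _ ->.
  by rewrite !slice_point_mul.
have FE z : D z -> F z = \sum_t tens (g t z) (e t).
  move=> Dz; rewrite sumE [LHS]surjective_pairing; have [-> ->] := Fc z Dz.
  by congr pair; apply: eq_bigr => k _ /=; case: (c1 k z) (c2 k z) => ? ? [].
have g_hol t z : D z -> is_derive z (1 : C) (g t) (dg t z).
  by move=> /g_nash-/(_ t)[U [_ Uz _ + _]] => /(_ z Uz) /derivableP.
have [l [lc lE]] := real_coordinates IJ.
have dg_cont t z : D z -> {for z, continuous (dg t)}.
  exact: (coordinate_continuous Do FE g_hol lc lE FC1).
have dg_nash t : complex_nash D (dg t).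
  exact: (complex_nash_derive Do (@dg_cont t) (g_nash t)).
have ddg_spec t z : D z -> derivable (dg t) z (1 : C) /\ {for z, continuous (ddg t)}.
  exact: (derivable_derive Do (g_hol t) (@dg_cont t)).
have dg_hol t z : D z -> is_derive z (1 : C) (dg t) (ddg t z).
  by move=> Dz; exact/derivableP/(ddg_spec t z Dz).1.
have ddg_cont t z : D z -> {for z, continuous (ddg t)}.
  by move=> Dz; exact: (ddg_spec t z Dz).2.
(* [slice_derivative] differentiates the chosen stem function [G]; agreement with [F] on the open
   set [D] carries the expansion over. *)
have GE z : D z -> G z = \sum_t tens (g t z) (e t).
  by move=> Dz; rewrite GF // FE.
have dGE z : D z -> d_z G z = \sum_t tens (dg t z) (e t).
  exact: (d_zE Do GE g_hol).
have dGaE z : D z -> d_z G z = d_alpha G z.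
  by move=> Dz; rewrite dGE // (d_alphaE Do GE g_hol Dz).
(* Since [d_z G] is [d_alpha G] on [D], its symmetry is that of the derivative along horizontal
   lines. *)
have sdG : stem_function D (d_z G).
  split=> // z Dz; rewrite !dGaE //; last exact: Dc.
  have := is_derive_line_re_conj sG Dz (is_derive_line_re Do GE g_hol Dz).
  rewrite -(d_alphaE Do GE g_hol Dz) => -[_ <-].
  by case: (z).
exists (d_z G); split; first exact: sdG.
- exact: slice_function_induced.
- exact: (holomorphic_coordinates Do dGE dg_hol ddg_cont).
exists I, J; split=> //.
(* [stem_nash] groups the real coefficients first by component of the stem function, then by base
   element. The witnesses transpose the [dg], and the Nash condition transposes them back. *)
exists (fun k z => Re (dg (inl k) z) +i* Re (dg (inr k) z)).
exists (fun k z => Im (dg (inl k) z) +i* Im (dg (inr k) z)).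
have eta (h : C -> C) : (fun z => Re (h z) +i* Im (h z)) = h.
  by apply/funext => z; case: (h z).
split=> [z Dz|k]; first by rewrite dGE // sumE.
split.
- have /= -> := eta (dg (inl k)); exact: dg_nash.
- have /= -> := eta (dg (inr k)); exact: dg_nash.
Qed.
End SliceDerivative.

Theorem proposition5p11 (R : realType) (A : hypercomplex)
  (Omega : set (carrier R A)) (f : carrier R A -> carrier R A) :
  open Omega -> circular Omega -> slice_nash Omega f ->
  forall n : nat, (1 <= n)%N ->
    slice_nash Omega (iter n (slice_derivative Omega) f).
Proof.
move=> _ _ fN n _; elim: n => // n IH; exact: slice_nash_derivative.
Qed.
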